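(* Let $Y$ be a continuous Lagrangian path on $[a,b]$ with associated continuous Lidskii angles $\varphi_j(t)$, $j\in\{1,\dots,n\}$, $t\in[a,b]$ (the continuous Lidskii angles of the symplectic orthogonal matrix $Z_Y(t)$). Let $q_j(t)$ and $q_j^*(t)$ be the integers satisfying $\varphi_j(t)\in[2\pi q_j(t),2\pi(q_j(t)+1))$ and $\varphi_j(t)\in(2\pi q_j^*(t),2\pi(q_j^*(t)+1)]$ for $t\in[a,b]$. Then the oscillation number and the dual oscillation number of $Y$ on $[a,b]$ satisfy $$\mathcal N(Y,[a,b])=\sum_{j=1}^n\big(q_j(b)-q_j(a)\big),\qquad \mathcal N^*(Y,[a,b])=\sum_{j=1}^n\big(q_j^*(b)-q_j^*(a)\big).$$
   Context: Notation. $n\in\mathbb N$, $[a,b]\subseteq\mathbb R$, $\mathcal J=\begin{pmatrix}0&I\\ -I&0\end{pmatrix}\in\mathbb R^{2n\times2n}$, $E=\begin{pmatrix}0\\ I\end{pmatrix}\in\mathbb R^{2n\times n}$. A real $2n\times 2n$ matrix $S$ is symplectic if $S^T\mathcal JS=\mathcal J$. A Lagrangian plane is a constant $Y\in\mathbb R^{2n\times n}$ with $Y^T\mathcal JY=0$ and $\operatorname{rank}Y=n$. A continuous Lagrangian path on $[a,b]$ is a continuous $Y:[a,b]\to\mathbb R^{2n\times n}$ such that every $Y(t)$ is a Lagrangian plane. We write $Y=\begin{pmatrix}X\\ U\end{pmatrix}$ with $n\times n$ blocks (similarly $\hat Y$ with $\hat X,\hat U$). The Wronskian is $W(Y,\hat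 Y)=Y^T\mathcal J\hat Y$. Comparative index. For Lagrangian planes $Y,\hat Y$ put $\mathcal M=(I-X^\dagger X)W(Y,\hat Y)$, $V=I-\mathcal M^\dagger\mathcal M$, $\mathcal P=V[W(Y,\hat Y)]^TX^\dagger\hat XV$ (a symmetric matrix), where $\dagger$ is the Moore–Penrose pseudoinverse. The comparative index and dual comparative index are $\mu(Y,\hat Y)=\operatorname{rank}\mathcal M+\operatorname{ind}\mathcal P$, $\mu^*(Y,\hat Y)=\operatorname{rank}\mathcal M+\operatorname{ind}(-\mathcal P)$, with $\operatorname{ind}$ the number of negative eigenvalues. Oscillation numbers. For a continuous Lagrangian path $Y$ on $[a,b]$ take a partition $a=t_0<t_1<\dots<t_p=b$ and real symplectic matrix functions $R_k(t)$, $k=0,\dots,p-1$, with $R_k$ continuous on $[t_k,t_{k+1}]$ and such that, for each $k$, both $\operatorname{rank}W(R_k(t)E,Y(t))$ and $\operatorname{rank}\big((I\ \,0)R_k(t)E\big)$ are constant for $t\in[t_k,t_{k+1}]$. Then $$\mathcal N(Y,[a,b]):=\sum_{k=0}^{p-1}\big[\mu(Y(t_{k+1}),R_k(t_{k+1})E)-\mu(Y(t_k),R_k(t_k)E)\big],$$ $$\mathcal N^*(Y,[a,b]):=\sum_{k=0}^{p-1}\big[\mu^*(Y(t_k),R_k(t_k)E)-\mu^*(Y(t_{k+1}),R_k(t_{k+1})E)\big].$$ Such partitions and systems exist and the values do not depend on their choice. Symplectic orthogonal matrix of a path. $Z_Y(t)=\begin{pmatrix}\mathcal JY(t)K_Y(t)&Y(t)K_Y(t)\end{pmatrix}$,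 $K_Y(t)=[Y^T(t)Y(t)]^{-1/2}>0$; $Z_Y(t)$ is symplectic and orthogonal. Lidskii angles. For a real symplectic $S=\begin{pmatrix}S_{11}&S_{12}\\ S_{21}&S_{22}\end{pmatrix}$ the matrix $W_S=(S_{11}-iS_{12})^{-1}(S_{11}+iS_{12})$ is well defined, symmetric and unitary; writing its eigenvalues as $\exp(i\varphi_j)$, the real numbers $\varphi_1,\dots,\varphi_n$ (each determined up to $2\pi\mathbb Z$) are the Lidskii angles of $S$. For continuous $S(t)$ they can be, and are, chosen as continuous functions of $t\in[a,b]$. *)

(* Defs.v *)
From mathcomp Require Import all_boot all_order all_algebra.
From mathcomp Require Import polyrcf complex.
From mathcomp Require Import all_classical all_reals all_analysis.
Set Implicit Arguments.
Unset Strict Implicit.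
Unset Printing Implicit Defensive.
Import Order.TTheory GRing.Theory Num.Theory.
Import numFieldNormedType.Exports.
Local Open Scope classical_set_scope.
Local Open Scope ring_scope.

Section LinearAlgebra.
Variable R : realType.

Definition is_moore_penrose m n (A : 'M[R]_(m, n)) (B : 'M[R]_(n, m)) : Prop :=
  [/\ A *m B *m A = A, B *m A *m B = B,
      (A *m B)^T = A *m B & (B *m A)^T = B *m A].

(* [is_moore_penrose A] has exactly one solution, so the default 0 is never
   used; MathComp's [pinvmx] is only a partial inverse and would be wrong. *)
Definition moore_penrose m n (A : 'M[R]_(m, n)) : 'M[R]_(n, m) :=
  xget 0 [set B | is_moore_penrose A B].

(* Eigenvalues are counted with their multiplicity as roots of the
   characteristic polynomial. *)
Definition ind n (P : 'M[R]_n) : nat :=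
  (\sum_(x <- rootsR (char_poly P) | (x < 0)%R) mup x (char_poly P))%N.

Definition is_posdef n (A : 'M[R]_n) : Prop :=
  A^T = A /\ forall v : 'cV[R]_n, v != 0 -> 0 < (v^T *m A *m v) 0 0.

(* A^{-1/2}: the positive definite K with K^2 = A^{-1}, which exists and is
   unique when A is positive definite. *)
Definition invsqrtmx n (A : 'M[R]_n) : 'M[R]_n :=
  xget 0 [set K | is_posdef K /\ K *m K = invmx A].

End LinearAlgebra.

Section Symplectic.
Variables (R : realType) (n : nat).

Definition Jmx : 'M[R]_(n + n) := block_mx 0 1%:M (- 1%:M) 0.

Definition Emx : 'M[R]_(n + n, n) := col_mx 0 1%:M.

Definition symplectic (S : 'M[R]_(n + n)) : Prop := S^T *m Jmx *m S = Jmx.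

Definition lagrangian_plane (Y : 'M[R]_(n + n, n)) : Prop :=
  Y^T *m Jmx *m Y = 0 /\ \rank Y = n.

Definition lagrangian_path (a b : R) (Y : R -> 'M[R]_(n + n, n)) : Prop :=
  {within `[a, b], continuous Y} /\
  forall t, t \in `[a, b] -> lagrangian_plane (Y t).

Definition wronskian (Y Yh : 'M[R]_(n + n, n)) : 'M[R]_n := Y^T *m Jmx *m Yh.

Definition comp_M (Y Yh : 'M[R]_(n + n, n)) : 'M[R]_n :=
  let X := usubmx Y in (1%:M - moore_penrose X *m X) *m wronskian Y Yh.

Definition comp_V (Y Yh : 'M[R]_(n + n, n)) : 'M[R]_n :=
  let M := comp_M Y Yh in 1%:M - moore_penrose M *m M.

Definition comp_P (Y Yh : 'M[R]_(n + n, n)) : 'M[R]_n :=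
  let V := comp_V Y Yh in
  V *m (wronskian Y Yh)^T *m moore_penrose (usubmx Y) *m usubmx Yh *m V.

Definition comp_index (Y Yh : 'M[R]_(n + n, n)) : nat :=
  (\rank (comp_M Y Yh) + ind (comp_P Y Yh))%N.

Definition dual_comp_index (Y Yh : 'M[R]_(n + n, n)) : nat :=
  (\rank (comp_M Y Yh) + ind (- comp_P Y Yh))%N.

(* The points of the partition are t_0 = a followed by the list s, and
   t_k = nth a (a :: s) k; here [Rs k] is the matrix function R_k. *)
Definition osc_system (a b : R) (Y : R -> 'M[R]_(n + n, n))
    (s : seq R) (Rs : nat -> R -> 'M[R]_(n + n)) : Prop :=
  itv_partition a b s /\
  forall k, (k < size s)%N ->
    let I := `[nth a (a :: s) k, nth a (a :: s) k.+1] in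
    [/\ {within [set` I], continuous (Rs k)},
        forall t, t \in I -> symplectic (Rs k t),
        forall t u, t \in I -> u \in I ->
          \rank (wronskian (Rs k t *m Emx) (Y t)) =
          \rank (wronskian (Rs k u *m Emx) (Y u))
      & forall t u, t \in I -> u \in I ->
          \rank (row_mx 1%:M 0 *m Rs k t *m Emx : 'M[R]_n) =
          \rank (row_mx 1%:M 0 *m Rs k u *m Emx : 'M[R]_n)].

Definition osc_sum (a : R) (Y : R -> 'M[R]_(n + n, n))
    (s : seq R) (Rs : nat -> R -> 'M[R]_(n + n)) : int :=
  \sum_(k < size s)
    let t := nth a (a :: s) in
    ((comp_index (Y (t k.+1)) (Rs k (t k.+1) *m Emx))%:Z
     - (comp_index (Y (t k)) (Rs k (t k) *m Emx))%:Z).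

Definition dual_osc_sum (a : R) (Y : R -> 'M[R]_(n + n, n))
    (s : seq R) (Rs : nat -> R -> 'M[R]_(n + n)) : int :=
  \sum_(k < size s)
    let t := nth a (a :: s) in
    ((dual_comp_index (Y (t k)) (Rs k (t k) *m Emx))%:Z
     - (dual_comp_index (Y (t k.+1)) (Rs k (t k.+1) *m Emx))%:Z).

(* For a continuous Lagrangian path, admissible systems exist and the sums do
   not depend on them, so each set below is a singleton and the default value 0
   is never used. *)
Definition osc_number (Y : R -> 'M[R]_(n + n, n)) (a b : R) : int :=
  xget 0 [set N | exists s Rs, osc_system a b Y s Rs /\ N = osc_sum a Y s Rs].

Definition dual_osc_number (Y : R -> 'M[R]_(n + n, n)) (a b : R) : int :=
  xget 0
    [set N | exists s Rs, osc_system a b Y s Rs /\ N = dual_osc_sum a Y s Rs].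

Definition Zmx (Y : 'M[R]_(n + n, n)) : 'M[R]_(n + n) :=
  let K := invsqrtmx (Y^T *m Y) in row_mx (Jmx *m Y *m K) (Y *m K).

Definition complexmx (A : 'M[R]_n) : 'M[R[i]]_n := map_mx (real_complex R) A.

Definition lidskii_mx (S : 'M[R]_(n + n)) : 'M[R[i]]_n :=
  let S11 := complexmx (ulsubmx S) in
  let S12 := complexmx (ursubmx S) in
  invmx (S11 - 'i%C *: S12) *m (S11 + 'i%C *: S12).

Definition expi (x : R) : R[i] := (cos x +i* sin x)%C.

(* The numbers exp (i phi_j) are the eigenvalues of W_S, with multiplicity. *)
Definition lidskii_angles (S : 'M[R]_(n + n)) (phi : 'I_n -> R) : Prop :=
  char_poly (lidskii_mx S) = \prod_(j < n) ('X - (expi (phi j))%:P).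

Definition continuous_lidskii_angles (a b : R) (S : R -> 'M[R]_(n + n))
    (phi : 'I_n -> R -> R) : Prop :=
  (forall j, {within `[a, b], continuous (phi j)}) /\
  forall t, t \in `[a, b] -> lidskii_angles (S t) (phi ^~ t).

End Symplectic.

(* Main.v *)
(* The comparative index is reduced to inertia indices.  For a Lagrangian plane
   Y = (X; U) choose a real x such that T = x X - U is invertible; then
   D = X T^-1 is symmetric, X = D T, and the Wronskian of Y and Yh is
   T^T (Dh - D) Th.  Hence both planes and the vertical plane become graphs of
   the symmetric matrices D, Dh and 0, and a generalized Schur complement of
   [[D, Dh], [Dh, Dh]], which is congruent to diag (D - Dh, Dh), gives
     mu (Y, Yh) = ind (Dh - D) + ind (- Dh) - ind (- D),
   and similarly for the dual index.  Along an admissible system the ranks of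
   Dh - D and Dh are constant, so their inertias are locally constant, and the
   index changes only through ind (- D).  On the other side the eigenvalues of
   the Lidskii matrix are the Moebius images ((x + i) d - 1) / ((x - i) d - 1)
   of the eigenvalues d of D; with x = cot alpha, the sign of d tells on which of
   the arcs (0, 2 alpha), (2 alpha, 2 pi) the angle lies, so that ind (- D) plus
   the sum of the q_j is locally constant as well. *)
Require Import Defs.
From mathcomp Require Import all_boot all_order all_algebra.
From mathcomp Require Import polyrcf complex.
From mathcomp Require Import all_classical all_reals all_analysis.
From mathcomp Require Import ring lra zify.
Set Implicit Arguments.
Unset Strict Implicit.
Unset Printing Implicit Defensive.
Import Order.TTheory GRing.Theory Num.Theory.
Import numFieldNormedType.Exports.
Local Open Scope classical_set_scope.
Local Open Scope ring_scope.

(** * Real spectral theorem *)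

Lemma char_poly_similar (F : fieldType) n (P Q B : 'M[F]_n) : Q *m P = 1%:M ->
  char_poly (P *m B *m Q) = char_poly B.
Proof.
move=> QP; have PQ := mulmx1C QP.
rewrite /char_poly /char_poly_mx.
have -> : 'X%:M - map_mx polyC (P *m B *m Q) =
    map_mx polyC P *m ('X%:M - map_mx polyC B) *m map_mx polyC Q.
  rewrite mulmxBr mulmxBl !map_mxM/=; congr (_ - _).
  by rewrite scalar_mxC -mulmxA -map_mxM PQ map_mx1 mulmx1.
by rewrite !det_mulmx mulrAC -det_mulmx -map_mxM PQ map_mx1 det1 mul1r.
Qed.

Section RealSpectral.
Variable R : realType.

Lemma trmxN m n (A : 'M[R]_(m, n)) : (- A)^T = - A^T.
Proof. exact: linearN. Qed.

Lemma trmxD m n (A B : 'M[R]_(m, n)) : (A + B)^T = A^T + B^T.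
Proof. exact: linearD. Qed.

Lemma trmxB m n (A B : 'M[R]_(m, n)) : (A - B)^T = A^T - B^T.
Proof. exact: linearB. Qed.

Lemma mulmxtr_ge0 n (v : 'rV[R]_n) : 0 <= (v *m v^T) 0 0.
Proof. by rewrite mxE sumr_ge0// => i _; rewrite mxE -expr2 sqr_ge0. Qed.

Lemma mulmxtr_eq0 n (v : 'rV[R]_n) : ((v *m v^T) 0 0 == 0) = (v == 0).
Proof.
apply/idP/eqP => [|->]; last by rewrite mul0mx mxE.
rewrite mxE psumr_eq0 => [/allP h|i _]; last by rewrite mxE -expr2 sqr_ge0.
apply/rowP => i; rewrite mxE; apply/eqP.
by have := h i (mem_index_enum _); rewrite mxE /= -expr2 sqrf_eq0.
Qed.

Lemma mulmxtr_gt0 n (v : 'rV[R]_n) : v != 0 -> 0 < (v *m v^T) 0 0.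
Proof. by move=> v0; rewrite lt_def mulmxtr_eq0 v0 mulmxtr_ge0. Qed.

(** Over the complex numbers the matrix is hermitian with a real spectrum; a real root there is a
    root of the real characteristic polynomial. *)
Lemma symmetric_eigenvalue n (A : 'M[R]_n.+1) : A^T = A -> exists a, eigenvalue A a.
Proof.
move=> As; pose B := map_mx (real_complex R) A.
have Bh : B \is hermsymmx.
  apply: realsym_hermsym.
    by apply/is_hermitianmxP; rewrite expr0 scale1r map_mx_id// map_trmx As.
  by apply/mxOverP => i j; rewrite mxE; apply/complex_realP; exists (A i j).
have Bn := hermitian_normalmx Bh.
have /mxOverP/(_ 0 0)/complex_realP[a aE] := hermitian_spectral_diag_real Bh.
exists a; rewrite eigenvalue_root_char -(fmorph_root (real_complex R)).
rewrite map_char_poly -eigenvalue_root_char; apply/eigenvalueP.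
exists (row 0 (spectralmx B)).
  have /orthomx_spectralP := Bn => /(congr1 (mulmx (row 0 (spectralmx B)))).
  rewrite -/B => ->; rewrite !mulmxA -row_mul mulmxV ?spectral_unit//.
  by rewrite row1 -rowE row_diag_mx -scalemxAl -rowE aE.
apply/eqP => r0; have := spectral_unit B.
rewrite -row_free_unit => /row_freeP[M] /(congr1 (row 0)).
rewrite row_mul r0 mul0mx row1 => /rowP/(_ 0)/eqP.
by rewrite !mxE !eqxx eq_sym oner_eq0.
Qed.

(** The reflection along [e - v], with [e] the first basis vector, exchanges [e] and [v]; the
    identity serves when [v = e]. *)
Lemma householder n (v : 'rV[R]_n.+1) : (v *m v^T) 0 0 = 1 ->
  exists H : 'M[R]_n.+1, [/\ H^T = H, H *m H = 1%:M & delta_mx 0 0 *m H = v].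
Proof.
move=> v1; pose e : 'rV[R]_n.+1 := delta_mx 0 0.
have ev : (e *m v^T) = (v 0 0)%:M.
  by apply/matrixP => i j; rewrite -rowE !ord1 !mxE.
have ve : v *m e^T = (v 0 0)%:M by rewrite -[LHS]trmxK trmx_mul trmxK ev tr_scalar_mx.
have ee : e *m e^T = 1%:M.
  by apply/matrixP => i j; rewrite -rowE !ord1 !mxE !eqxx.
have vv : v *m v^T = 1%:M by rewrite [LHS]mx11_scalar v1.
have [ve0|nve0] := eqVneq v e.
  by exists 1%:M; rewrite trmx1 !mulmx1 ve0.
have v00 : v 0 0 != 1.
  apply: contra nve0 => /eqP v00; rewrite -subr_eq0 -mulmxtr_eq0.
  rewrite trmxB mulmxBl !mulmxBr ee vv ev ve v00 !mxE.
  by rewrite !eqxx; apply/eqP; ring.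
have [w wE] : exists w, w = e - v by exists (e - v).
have ww : w *m w^T = (2 * (1 - v 0 0))%:M.
  rewrite wE trmxB mulmxBl !mulmxBr ee vv ev ve.
  by apply/matrixP => i j; rewrite !mxE !ord1 !eqxx !mulr1n; ring.
exists (1%:M - (1 - v 0 0)^-1 *: (w^T *m w)); split.
- by rewrite trmxB trmx1 linearZ/= trmx_mul trmxK.
- rewrite mulmxBl mul1mx mulmxBr mulmx1 -scalemxAl -scalemxAr.
  rewrite mulmxA -(mulmxA w^T w) ww mul_mx_scalar -scalemxAl scalerA.
  have -> : (1 - v 0 0)^-1 * (2 * (1 - v 0 0)) = 2.
    by field; rewrite subr_eq0 eq_sym.
  by move: (w^T *m w) => X; apply/matrixP => i j; rewrite !mxE; ring.
- rewrite mulmxBr mulmx1 -scalemxAr mulmxA {1}wE trmxB mulmxBr ee ev -/e.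
  rewrite -raddfB/= mul_scalar_mx scalerA mulVf ?scale1r; first by rewrite wE subKr.
  by rewrite subr_eq0 eq_sym.
Qed.

(** Deflation: a reflection carrying the first basis vector to a unit eigenvector splits off a
    scalar block and leaves a smaller symmetric block for the induction. *)
Lemma real_spectral n (A : 'M[R]_n) : A^T = A ->
  exists (O : 'M[R]_n) (d : 'rV[R]_n), O *m O^T = 1%:M /\ A = O^T *m diag_mx d *m O.
Proof.
elim: n A => [|n IH] A As.
  by exists 1%:M, 0; rewrite trmx1 mulmx1; split=> //; apply/matrixP => -[].
have [a /eigenvalueP[v vA v0]] := symmetric_eigenvalue As.
pose u := (Num.sqrt ((v *m v^T) 0 0))^-1 *: v.
have uA : u *m A = a *: u by rewrite -scalemxAl vA !scalerA mulrC.
have u1 : (u *m u^T) 0 0 = 1.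
  rewrite linearZ/= -scalemxAl -scalemxAr scalerA mxE -invfM -expr2.
  by rewrite sqr_sqrtr ?mulmxtr_ge0// mulVf// mulmxtr_eq0.
have [H [Hs HH eH]] := householder u1.
pose B : 'M[R]_(1 + n) := H *m A *m H.
have Bs : B^T = B by rewrite /B !trmx_mul Hs As mulmxA.
have Br : delta_mx 0 0 *m B = a *: (delta_mx 0 0 : 'rV_(1 + n)).
  by rewrite /B !mulmxA eH uA -scalemxAl -eH -mulmxA HH mulmx1.
have B0 i : B 0 i = a *+ (i == 0).
  by move: Br => /matrixP/(_ 0 i); rewrite -rowE !mxE eqxx/= mulr_natr.
have AE : A = H *m B *m H.
  by rewrite /B !mulmxA HH mul1mx -mulmxA HH mulmx1.
clearbody B.
have urB : ursubmx B = 0.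
  apply/matrixP => i j; rewrite !mxE ord1 /= .
  by rewrite (_ : lshift _ _ = 0 :> 'I_(1 + n)) ?B0//; exact/val_inj.
have dlB : dlsubmx B = 0 by rewrite -[LHS]trmxK trmx_dlsub Bs urB trmx0.
have ulB : ulsubmx B = a%:M.
  apply/matrixP => i j; rewrite !mxE !ord1 /=.
  by rewrite (_ : lshift _ _ = 0 :> 'I_(1 + n)) ?B0//; exact/val_inj.
have [|O [d [OO dE]]] := IH (drsubmx B); first by rewrite trmx_drsub Bs.
pose P : 'M[R]_(1 + n) := block_mx 1%:M 0 0 O.
have PP : P *m P^T = 1%:M.
  rewrite /P tr_block_mx mulmx_block !trmx0 trmx1 OO !mulmx0 !mul0mx !addr0 add0r.
  by rewrite mulmx1 -scalar_mx_block.
have BE : B = P^T *m diag_mx (row_mx a%:M d) *m P.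
  rewrite -[LHS]submxK urB dlB ulB dE diag_mx_row /P tr_block_mx !mulmx_block.
  rewrite !trmx0 trmx1 !mulmx0 !mul0mx !addr0 !add0r mulmx1 mul1mx.
  congr block_mx; rewrite ?mul0mx//.
  by apply/matrixP => i j; rewrite !mxE !ord1 !mulr1n.
exists (P *m H), (row_mx a%:M d); split.
  by rewrite trmx_mul Hs !mulmxA -(mulmxA P) HH mulmx1.
by rewrite [LHS]AE BE trmx_mul Hs !mulmxA.
Qed.

Lemma ind_char_poly n (A : 'M[R]_n) (d : 'I_n -> R) :
  char_poly A = \prod_j ('X - (d j)%:P) -> ind A = (\sum_j (d j < 0)%R)%N.
Proof.
move=> cE; rewrite /ind; set p := char_poly A.
have p0 : p != 0 by rewrite monic_neq0// char_poly_monic.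
have pE : p = \prod_(x <- [seq d j | j <- index_enum 'I_n]) ('X - x%:P).
  by rewrite big_map.
have -> : (\sum_(x <- rootsR p | (x < 0)%R) mup x p =
    \sum_(x <- rootsR p | (x < 0)%R) \sum_j (d j == x))%N.
  apply: eq_bigr => x _; rewrite pE mu_prod_XsubC count_map -sum1_count.
  by rewrite big_mkcond.
rewrite exchange_big/=; apply: eq_bigr => j _.
have dr : d j \in rootsR p.
  have := roots_on_rootsR p0 (d j); rewrite in_itv/= => <-.
  by rewrite pE root_prod_XsubC map_f// mem_index_enum.
rewrite big_mkcond (bigD1_seq (d j))//=; last exact: uniq_roots.
rewrite eqxx big1 ?addn0; first by case: ifP.
by move=> x xd; rewrite eq_sym (negbTE xd); case: ifP.
Qed.

Lemma ind_diag n (O : 'M[R]_n) (d : 'rV[R]_n) : O *m O^T = 1%:M ->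
  ind (O^T *m diag_mx d *m O) = (\sum_j (d 0 j < 0)%R)%N.
Proof.
move=> OO; apply: ind_char_poly; rewrite char_poly_similar//.
rewrite char_poly_trig ?diag_mx_is_trig//.
by apply: eq_bigr => i _; rewrite mxE eqxx mulr1n.
Qed.

End RealSpectral.

(** * Inertia of symmetric matrices *)

Section Inertia.
Variable R : realType.

(** Quantifying over coefficient vectors also makes the rows of [B] independent: a relation between
    them would give the value 0. *)
Definition negdef_on k n (B : 'M[R]_(k, n)) (A : 'M[R]_n) :=
  forall v : 'rV[R]_k, v != 0 -> (v *m B *m A *m (v *m B)^T) 0 0 < 0.

Lemma negdef_onN1 k n (B : 'M[R]_(k, n)) (A : 'M[R]_n) :
  B *m A *m B^T = - 1%:M -> negdef_on B A.
Proof.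
move=> BAB v v0; rewrite trmx_mul !mulmxA -(mulmxA v) -(mulmxA v) BAB.
by rewrite mulmxN mulmx1 mulNmx mxE oppr_lt0 mulmxtr_gt0.
Qed.

Lemma mulmx_diag_quad k n (d : 'rV[R]_n) (E : 'M[R]_(k, n)) i j :
  (E *m diag_mx d *m E^T) i j = \sum_l d 0 l * E i l * E j l.
Proof.
rewrite mxE; apply: eq_bigr => l _; rewrite !mxE (bigD1 l)//= big1 => [|m ml].
  by rewrite !mxE eqxx mulr1n addr0 [E i l * _]mulrC.
by rewrite !mxE (negbTE ml) mulr0.
Qed.

(** The rows are eigenvectors of the negative eigenvalues [d], divided by the square root of [- d].
    Their inclusion in the row space of [A] later allows frames of orthogonal forms to be
    stacked. *)
Lemma exists_negative_frame n (A : 'M[R]_n) : A^T = A ->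
  exists k (B : 'M[R]_(k, n)),
    [/\ k = ind A, B *m A *m B^T = - 1%:M & (B <= A)%MS].
Proof.
move=> /real_spectral[ O [d [OO ->]]]; rewrite ind_diag//.
have OO' := mulmx1C OO.
pose S := [set j | d 0 j < 0]%SET.
have Slt (i : 'I_#|S|) : d 0 (enum_val i) < 0.
  by have := enum_valP i; rewrite inE.
pose E : 'M[R]_(#|S|, n) := \matrix_(i, j) ((Num.sqrt (- d 0 (enum_val i)))^-1 *+ (j == enum_val i)).
exists #|S|, (E *m O); split.
- rewrite -sum1_card big_mkcond/=; apply: eq_bigr => j _.
  by rewrite inE; case: (_ < _).
- rewrite trmx_mul !mulmxA -(mulmxA E O) OO mulmx1 -(mulmxA _ O) OO mulmx1.
  apply/matrixP => i j; rewrite mulmx_diag_quad !mxE.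
  rewrite (bigD1 (enum_val i))//= big1 => [|l li]; last first.
    by rewrite !mxE (negbTE li) mulr0 mul0r.
  rewrite !mxE eqxx addr0 (inj_eq enum_val_inj); case: eqVneq => [<-|_]; last first.
    by rewrite mulr0n mulr0 oppr0.
  rewrite mulr1n -mulrA -invfM -expr2 sqr_sqrtr; last by rewrite oppr_ge0 ltW.
  by rewrite invrN mulrN divff// lt_eqF.
(* Dividing each row once more by its eigenvalue gives the coefficients that express the frame
   through the rows of [A]. *)
- pose F : 'M[R]_(#|S|, n) := \matrix_(i, j) (((Num.sqrt (- d 0 (enum_val i)))^-1 / d 0 (enum_val i)) *+ (j == enum_val i)).
  apply/submxP; exists (F *m O).
  rewrite !mulmxA -(mulmxA F O) OO mulmx1; congr (_ *m _).
  apply/matrixP => i j; rewrite [RHS]mxE (bigD1 j)//= big1 => [|l lj]; last first.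
    by rewrite !mxE (negbTE lj) mulr0n mulr0.
  rewrite !mxE eqxx addr0; case: eqVneq => [->|_]; last by rewrite !mulr0n mul0r.
  by rewrite !mulr1n mulfVK// lt_eqF.
Qed.

Lemma exists_nonneg_frame n (A : 'M[R]_n) : A^T = A ->
  exists k (B : 'M[R]_(k, n)), [/\ (ind A + k)%N = n, row_free B &
    forall v : 'rV[R]_k, 0 <= (v *m B *m A *m (v *m B)^T) 0 0].
Proof.
move=> /real_spectral[ O [d [OO ->]]]; rewrite ind_diag//.
pose S := [set j | 0 <= d 0 j]%SET.
have Sge (i : 'I_#|S|) : 0 <= d 0 (enum_val i).
  by have := enum_valP i; rewrite inE.
pose E : 'M[R]_(#|S|, n) := \matrix_(i, j) ((j == enum_val i)%:R).
exists #|S|, (E *m O); split.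
- rewrite -sum1_card [X in (_ + X)%N]big_mkcond -big_split/= -[RHS]card_ord -sum1_card.
  by apply: eq_bigr => i _; rewrite inE leNgt; case: (_ < _).
- apply/row_freeP; exists (O^T *m E^T); rewrite mulmxA -(mulmxA E) OO mulmx1.
  apply/matrixP => i j; rewrite !mxE (bigD1 (enum_val i))//= big1 => [|l li].
    by rewrite !mxE eqxx mul1r addr0 (inj_eq enum_val_inj).
  by rewrite !mxE (negbTE li) mul0r.
- move=> v; rewrite !mulmxA !trmx_mul !mulmxA -(mulmxA _ O O^T) OO mulmx1.
  rewrite -(mulmxA _ O O^T) OO mulmx1 -(mulmxA _ E^T) -trmx_mul mulmx_diag_quad.
  apply: sumr_ge0 => l _; rewrite -mulrA -expr2.
  have [dl|dl] := leP 0 (d 0 l); first by rewrite mulr_ge0 ?sqr_ge0.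
  rewrite mxE big1 ?expr0n ?mulr0// => i _; rewrite mxE.
  case: eqP => [lE|]; last by rewrite mulr0.
  by have := Sge i; rewrite -lE leNgt dl.
Qed.

(** If [k] were larger, [B] and a nonnegative frame of [n - ind A] rows would be linearly dependent,
    giving a vector on which the form is both negative and nonnegative. *)
Lemma negdef_on_le k n (B : 'M[R]_(k, n)) (A : 'M[R]_n) : A^T = A ->
  negdef_on B A -> (k <= ind A)%N.
Proof.
move=> As Bneg; have [k' [B' [kE B'free B'ge]]] := exists_nonneg_frame As.
rewrite leqNgt; apply/negP => lt_k.
have : ~~ row_free (col_mx B B').
  apply/negP => /eqnP rE; have := rank_leq_col (col_mx B B'); rewrite rE; lia.
rewrite -kermx_eq0 => /rowV0Pn[u /sub_kermxP uB u0].
move: uB; rewrite -[u]hsubmxK mul_row_col => uB.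
have [v0|v0] := eqVneq (lsubmx u) 0.
  move: uB u0; rewrite v0 mul0mx add0r => /eqP; rewrite mulmx_free_eq0// => /eqP r0.
  by rewrite -[u]hsubmxK v0 r0 row_mx0 eqxx.
have := Bneg _ v0; rewrite (_ : lsubmx u *m B = - (rsubmx u *m B')); last first.
  by apply/eqP; rewrite -subr_eq0 opprK uB.
by rewrite trmxN mulNmx mulNmx mulmxN opprK ltNge B'ge.
Qed.

(** Sylvester's law of inertia: a negative frame [B] of the congruent form gives the frame [B *m C],
    and the inverse of [C] gives the reverse inequality. *)
Lemma ind_congr n (A C : 'M[R]_n) : A^T = A -> C \in unitmx ->
  ind (C *m A *m C^T) = ind A.
Proof.
have le (D E : 'M[R]_n) : D^T = D -> (ind (E *m D *m E^T) <= ind D)%N.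
  move=> Ds; have Ds' : (E *m D *m E^T)^T = E *m D *m E^T.
    by rewrite !trmx_mul trmxK Ds mulmxA.
  have [k [B [<- BE _]]] := exists_negative_frame Ds'.
  apply: (@negdef_on_le _ _ (B *m E)) => //; apply: negdef_onN1.
  by rewrite trmx_mul -BE !mulmxA.
move=> As Cu; apply/eqP; rewrite eqn_leq le//=.
have {1}-> : A = invmx C *m (C *m A *m C^T) *m (invmx C)^T.
  by rewrite !mulmxA mulVmx// mul1mx -mulmxA -trmx_mul mulVmx// trmx1 mulmx1.
by rewrite le// !trmx_mul trmxK As mulmxA.
Qed.

Lemma rank_diag_mx n (d : 'rV[R]_n) :
  \rank (diag_mx d) = (\sum_j (d 0 j != 0)%R)%N.
Proof.
elim: n d => [|n IH] d; first by rewrite big_ord0 flatmx0 mxrank0.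
pose e : 'rV[R]_(1 + n) := d.
have := rank_diag_block_mx (diag_mx (lsubmx e)) (diag_mx (rsubmx e)).
rewrite -diag_mx_row hsubmxK => rE; rewrite [LHS]rE IH big_ord_recl.
have -> : diag_mx (lsubmx e) = (d 0 ord0)%:M.
  apply/matrixP => i j; rewrite !mxE !ord1; congr (d _ _ *+ _); exact/val_inj.
congr (_ + _)%N; last first.
  by apply: eq_bigr => i _; rewrite mxE; rewrite (_ : rshift 1 i = lift ord0 i :> 'I_(1 + n))//; exact/val_inj.
have [->|d0] := eqVneq (d 0 ord0) 0; first by rewrite raddf0 mxrank0.
by rewrite mxrank_unit// unitmxE det_scalar unitrX// unitfE.
Qed.

Lemma indD_rank n (A : 'M[R]_n) : A^T = A -> (ind A + ind (- A))%N = \rank A.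
Proof.
move=> /real_spectral[ O [d [OO ->]]].
have NE : - (O^T *m diag_mx d *m O) = O^T *m diag_mx (- d) *m O.
  by rewrite raddfN/= mulmxN mulNmx.
have Ou : O \in unitmx by have [] := mulmx1_unit OO.
rewrite NE !ind_diag// -big_split/= mxrankMfree ?row_free_unit//.
rewrite -mxrank_tr trmx_mul trmxK tr_diag_mx mxrankMfree ?row_free_unit//.
rewrite rank_diag_mx; apply: eq_bigr => i _.
by rewrite !mxE oppr_lt0; case: (ltgtP (d 0 i)).
Qed.

(** Lower bounds on the negative indices of a form and of its opposite become equalities once the
    rank bounds their sum from above. *)
Lemma addn_leq_squeeze a b c a' b' c' : (a + b <= c -> a' + b' <= c' ->
  c + c' <= (a + a') + (b + b') -> c = a + b)%N.
Proof. by lia. Qed.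

(** A negative frame in the row space of one form is annihilated by the other, so the two frames
    stack. The same bound for the opposite forms, with subadditivity of the rank, gives equality. *)
Lemma ind_add_ortho n (A B : 'M[R]_n) : A^T = A -> B^T = B -> A *m B = 0 ->
  ind (A + B) = (ind A + ind B)%N.
Proof.
have le (D E : 'M[R]_n) : D^T = D -> E^T = E -> D *m E = 0 ->
    (ind D + ind E <= ind (D + E))%N.
  move=> Ds Es DE; have ED : E *m D = 0 by rewrite -Ds -Es -trmx_mul DE trmx0.
  have [k [F [<- FE /submxP[K FK]]]] := exists_negative_frame Ds.
  have [l [G [<- GE /submxP[L GL]]]] := exists_negative_frame Es.
  have FE0 : F *m E = 0 by rewrite FK -mulmxA DE mulmx0.
  have GD0 : G *m D = 0 by rewrite GL -mulmxA ED mulmx0.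
  have EF0 : E *m F^T = 0 by rewrite -Es -trmx_mul FE0 trmx0.
  have DG0 : D *m G^T = 0 by rewrite -Ds -trmx_mul GD0 trmx0.
  apply: (@negdef_on_le _ _ (col_mx F G)); first by rewrite trmxD Ds Es.
  apply: negdef_onN1; rewrite mul_col_mx tr_col_mx mul_col_row.
  rewrite !mulmxDr FE0 GD0 addr0 add0r FE GE -!mulmxA DG0 EF0 !mulmx0.
  by rewrite scalar_mx_block opp_block_mx !oppr0.
move=> As Bs AB.
have lN : (ind (- A) + ind (- B) <= ind (- (A + B)))%N.
  rewrite opprD; apply: le; rewrite ?trmxN ?As ?Bs//.
  by rewrite mulmxN mulNmx AB !oppr0.
apply: (addn_leq_squeeze _ lN); first exact: le.
by rewrite !indD_rank ?mxrank_add// trmxD As Bs.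
Qed.

Lemma ind_block_diag m n (A : 'M[R]_m) (B : 'M[R]_n) : A^T = A -> B^T = B ->
  ind (block_mx A 0 0 B) = (ind A + ind B)%N.
Proof.
have le (D : 'M[R]_m) (E : 'M[R]_n) : D^T = D -> E^T = E ->
    (ind D + ind E <= ind (block_mx D 0 0 E))%N.
  move=> Ds Es.
  have [k [F [<- FE _]]] := exists_negative_frame Ds.
  have [l [G [<- GE _]]] := exists_negative_frame Es.
  apply: (@negdef_on_le _ _ (block_mx F 0 0 G)).
    by rewrite tr_block_mx !trmx0 Ds Es.
  apply: negdef_onN1; rewrite tr_block_mx !mulmx_block !trmx0.
  rewrite !(mulmx0, mul0mx, addr0, add0r) FE GE.
  by rewrite scalar_mx_block opp_block_mx !oppr0.
move=> As Bs.
have lN : (ind (- A) + ind (- B) <= ind (- (block_mx A 0 0 B)))%N.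
  by rewrite opp_block_mx !oppr0 le ?trmxN ?As ?Bs.
apply: (addn_leq_squeeze _ lN); first exact: le.
by rewrite !indD_rank ?rank_diag_block_mx// tr_block_mx !trmx0 As Bs.
Qed.

(** Congruence by diag (1, -1) turns the matrix into its opposite, so both indices equal half of the
    rank, which is twice that of [N]. *)
Lemma ind_antidiag m n (N : 'M[R]_(m, n)) : ind (block_mx 0 N N^T 0) = \rank N.
Proof.
have Hs : (block_mx 0 N N^T 0)^T = block_mx 0 N N^T 0.
  by rewrite tr_block_mx !trmx0 trmxK.
have IN : ind (- block_mx 0 N N^T 0) = ind (block_mx 0 N N^T 0).
  rewrite -(@ind_congr _ _ (block_mx 1%:M 0 0 (- 1%:M)) Hs).
    congr ind; rewrite tr_block_mx !mulmx_block !trmx0 trmxN !trmx1.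
    rewrite !(mulmx0, mul0mx, addr0, add0r, mulmxN, mulNmx, mulmx1, mul1mx, opprK, oppr0).
    by rewrite opp_block_mx !oppr0.
  by rewrite unitmxE det_lblock det1 mul1r -scaleN1r detZ det1 mulr1 unitrX// unitrN1.
have := indD_rank Hs; rewrite IN.
have -> : \rank (block_mx 0 N N^T 0) = (\rank N + \rank N)%N.
  rewrite -[X in _ = (_ + X)%N](mxrank_tr N) -rank_diag_block_mx.
  rewrite -(@mxrankMfree _ _ _ _ _ (block_mx 0 1%:M 1%:M 0 : 'M[R]_(m + n, n + m))).
    by rewrite mulmx_block !(mulmx0, mul0mx, addr0, add0r, mulmx1).
  apply/row_freeP; exists (block_mx 0 1%:M 1%:M 0).
  by rewrite mulmx_block !(mulmx0, mul0mx, addr0, add0r, mulmx1) -scalar_mx_block.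
by rewrite !addnn => /double_inj.
Qed.

End Inertia.

(** * The comparative index in graph coordinates *)

Section StaticIndex.
Variable R : realType.

(** The pseudoinverse is [G *m A^T], where [G] inverts the nonzero eigenvalues of [A^T *m A]; zero
    eigenvalues are kept because the inverse of 0 is 0. *)
Lemma moore_penrose_exists m n (A : 'M[R]_(m, n)) : exists B, is_moore_penrose A B.
Proof.
have Gs : (A^T *m A)^T = A^T *m A by rewrite trmx_mul trmxK.
have [P [d [PP GE]]] := real_spectral Gs.
pose e : 'rV[R]_n := \row_j (d 0 j)^-1.
pose G := P^T *m diag_mx e *m P.
have Gsym : G^T = G by rewrite !trmx_mul trmxK tr_diag_mx mulmxA.
have mulD (x y : 'rV[R]_n) : P^T *m diag_mx x *m P *m (P^T *m diag_mx y *m P) =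
    P^T *m diag_mx (\row_j (x 0 j * y 0 j)) *m P.
  by rewrite !mulmxA -(mulmxA _ P) PP mulmx1 -(mulmxA P^T) mulmx_diag.
have GA : A^T *m A *m G = G *m (A^T *m A).
  rewrite GE !mulD; congr (_ *m diag_mx _ *m _).
  by apply/rowP => j; rewrite !mxE mulrC.
have GAG : G *m (A^T *m A) *m G = G.
  rewrite GE !mulD; congr (_ *m diag_mx _ *m _); apply/rowP => j; rewrite !mxE.
  by have [->|d0] := eqVneq (d 0 j) 0; rewrite ?invr0 ?mul0r// mulVf ?mul1r.
have AGA : A^T *m A *m G *m (A^T *m A) = A^T *m A.
  rewrite GE !mulD; congr (_ *m diag_mx _ *m _); apply/rowP => j; rewrite !mxE.
  by have [->|d0] := eqVneq (d 0 j) 0; rewrite ?mul0r// divff ?mul1r.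
(* The defect [E] satisfies [E^T *m E = 0], so each of its columns has norm 0. *)
have AK : A *m (G *m (A^T *m A)) = A.
  apply/eqP; rewrite -subr_eq0; apply/eqP; set E := _ - _.
  have : E^T *m E = 0.
    have -> : E = A *m (G *m (A^T *m A) - 1%:M) by rewrite mulmxBr mulmx1.
    rewrite trmx_mul trmxB trmx1 trmx_mul Gs Gsym.
    by rewrite [LHS]mulmxA -(mulmxA _ A^T A) mulmxBl mul1mx AGA subrr mul0mx.
  move=> EE; apply/matrixP => i j; rewrite mxE; apply/eqP.
  have /matrixP/(_ j j) := EE; rewrite !mxE => /eqP.
  rewrite psumr_eq0 => [/allP/(_ i (mem_index_enum _))|k _].
    by rewrite !mxE /= -expr2 sqrf_eq0.
  by rewrite mxE -expr2 sqr_ge0.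
clearbody G; exists (G *m A^T); split.
- by rewrite -mulmxA -mulmxA AK.
- by rewrite -(mulmxA G) mulmxA GAG.
- by rewrite !trmx_mul trmxK Gsym mulmxA.
- by rewrite trmx_mul -mulmxA trmx_mul !trmxK Gsym mulmxA GA mulmxA.
Qed.

Lemma moore_penroseP m n (A : 'M[R]_(m, n)) : is_moore_penrose A (moore_penrose A).
Proof.
by rewrite /moore_penrose; case: xgetP => //= H; have [B /H] := moore_penrose_exists A.
Qed.

(* A generalized Haynsworth inertia formula: [Q] projects onto the kernel of [A]
   and [g] is a generalized inverse of [A]. *)
Lemma ind_generalized_schur m n (A Q g : 'M[R]_m) (B : 'M[R]_(m, n)) (C : 'M[R]_n) :
  A^T = A -> C^T = C -> Q^T = Q -> Q *m A = 0 -> g *m A = 1%:M - Q ->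
  let N := Q *m B in let V := 1%:M - moore_penrose N *m N in
  let S := V *m (B^T *m g *m B - C) *m V in
  ind (block_mx A B B^T C) = (ind A + \rank N + ind (- S))%N /\
  ind (- block_mx A B B^T C) = (ind (- A) + \rank N + ind S)%N.
Proof.
move=> As Cs Qs QA gA N V S.
have [NK KN Ns Es] := moore_penroseP N; set Np := moore_penrose N in V S NK KN Ns Es *.
have NE : Q *m B = N by [].
have [E EE] : exists E, E = Np *m N by eexists.
rewrite -EE in Es.
have VE : V = 1%:M - E by rewrite EE.
have SE : S = V *m (B^T *m g *m B - C) *m V by [].
clearbody S V Np N.
have Vs : V^T = V by rewrite VE trmxB trmx1 Es.
have AQ : A *m Q = 0 by rewrite -As -Qs -trmx_mul QA trmx0.
have AN : A *m N = 0 by rewrite -NE mulmxA AQ mul0mx.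
have NV : N *m V = 0 by rewrite VE mulmxBr EE mulmx1 mulmxA NK subrr.
have VN : V *m N^T = 0 by rewrite -Vs -trmx_mul NV trmx0.
have Ag : A *m g^T = 1%:M - Q by rewrite -As -trmx_mul gA trmxB trmx1 Qs.
have ANp : A *m Np^T = 0.
  by rewrite -KN -[Np *m N *m Np]mulmxA trmx_mul Ns !mulmxA AN !mul0mx.
have gQ : g^T - Q *m g^T = g - g *m Q.
  have -> : g^T - Q *m g^T = (1%:M - Q) *m g^T by rewrite mulmxBl mul1mx.
  by rewrite -gA -mulmxA Ag mulmxBr mulmx1.
have gQs : (g + Q *m g^T)^T = g + Q *m g^T.
  by rewrite trmxD trmx_mul trmxK Qs -[g^T in LHS](subrK (Q *m g^T)) gQ addrAC subrK.
(* [g] may fail to be symmetric, but [g + Q *m g^T] is symmetric. The added term makes [C']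
   symmetric and vanishes between two factors [V]. *)
pose C' := C - B^T *m g *m B - B^T *m (Q *m g^T) *m B.
have C's : C'^T = C'.
  rewrite /C' -addrA -opprD -mulmxDl -mulmxDr trmxB 2!trmx_mul trmxK Cs gQs.
  by rewrite mulmxA.
(* [Z] is chosen to remove from [C'] all but [V *m C' *m V]; the factor 1/2 shares [E *m C' *m E]
   between [N^T *m Z] and its transpose. Since [A *m Z = 0], the other blocks are unaffected. *)
pose Z := Np^T *m (C' *m V + 2^-1 *: (C' *m E)).
have AZ : A *m Z = 0 by rewrite mulmxA ANp mul0mx.
have ZA : Z^T *m A = 0 by rewrite -As -trmx_mul AZ trmx0.
have ZB : Z^T *m B = Z^T *m N.
  rewrite -[B in LHS]mul1mx -[1%:M](addrNK Q) -Ag mulmxDl NE mulmxDr !mulmxA ZA.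
  by rewrite !mul0mx add0r.
have NZ : N^T *m Z = E *m (C' *m V + 2^-1 *: (C' *m E)).
  by rewrite /Z mulmxA -trmx_mul -EE Es.
have ZN : Z^T *m N = (V *m C' + 2^-1 *: (E *m C')) *m E.
  rewrite -[LHS]trmxK trmx_mul trmxK NZ trmx_mul trmxD linearZ/= !trmx_mul.
  by rewrite C's Vs Es.
have VCV : V *m C' *m V = - S.
  have VBQ : V *m (B^T *m (Q *m g^T) *m B) = 0.
    have VNt : V *m (B^T *m Q) = 0 by rewrite -Qs -trmx_mul NE.
    by rewrite !mulmxA -(mulmxA V) VNt !mul0mx.
  by rewrite /C' mulmxBr VBQ subr0 SE !mulmxBr !mulmxBl opprB.
have C'E : C = C' + B^T *m g *m B + B^T *m (Q *m g^T) *m B.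
  by rewrite /C' addrAC !subrK.
have C'V : C' - N^T *m Z - Z^T *m N = V *m C' *m V.
  rewrite NZ ZN VE; clearbody C'; apply/eqP; rewrite -subr_eq0; apply/eqP.
  rewrite !(mulmxBl, mulmxBr, mulmxDl, mulmxDr, mulNmx, mulmxN, mul1mx, mulmx1) -!scalemxAl -!scalemxAr.
  rewrite !mulmxA.
  move: (E *m C' *m E) (E *m C') (C' *m E) => X1 X2 X3.
  by apply/matrixP => i j; rewrite !mxE; field.
clearbody Z C'.
(* Block elimination with [K] clears the part of [B] in the range of [A], leaving [N], and turns the
   lower corner into [- S]. *)
pose K := g^T *m B + Z.
have KT : K^T = B^T *m g + Z^T by rewrite trmxD trmx_mul trmxK.
have Hs : (block_mx A B B^T C)^T = block_mx A B B^T C by rewrite tr_block_mx trmxK As Cs.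
have HE : block_mx 1%:M 0 (- K^T) 1%:M *m block_mx A B B^T C *m (block_mx 1%:M 0 (- K^T) 1%:M)^T
    = block_mx A N N^T (- S).
  have KA : - K^T *m A + B^T = N^T.
    rewrite mulNmx trmxD mulmxDl ZA addr0 trmx_mul trmxK -mulmxA gA mulmxBr mulmx1.
    by rewrite opprB addrNK -NE trmx_mul Qs.
  have AK : - (A *m K) + B = N.
    by rewrite -[LHS]trmxK trmxD trmxN trmx_mul As -mulNmx KA trmxK.
  rewrite tr_block_mx !mulmx_block !trmx0 !trmx1 trmxN trmxK.
  rewrite !(mulmx0, mul0mx, addr0, add0r, mulmx1, mul1mx) KA mulmxN AK.
  congr block_mx.
  rewrite -VCV -C'V mulmxN mulNmx C'E KT /K mulmxDl mulmxDr ZB.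
  have -> : N^T *m (g^T *m B) = B^T *m (Q *m g^T) *m B.
    by rewrite -NE trmx_mul Qs !mulmxA.
  move: (B^T *m g *m B) (B^T *m (Q *m g^T) *m B) (N^T *m Z) (Z^T *m N) => X1 X2 X3 X4.
  by apply/matrixP => i j; rewrite !mxE; ring.
have Ss : S^T = S.
  by rewrite -[S]opprK -VCV trmxN !trmx_mul Vs C's mulmxA.
have NS : S *m N^T = 0 by rewrite SE -mulmxA VN mulmx0.
(* As [A *m N = 0] and [S *m N^T = 0], the diagonal and antidiagonal parts are orthogonal and their
   indices add. *)
have split_ind : ind (block_mx A N N^T (- S)) = (ind A + \rank N + ind (- S))%N /\
    ind (- block_mx A N N^T (- S)) = (ind (- A) + \rank N + ind S)%N.
  have -> : block_mx A N N^T (- S) = block_mx A 0 0 (- S) + block_mx 0 N N^T 0.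
    by rewrite add_block_mx !addr0 !add0r.
  have s1 : (block_mx A 0 0 (- S))^T = block_mx A 0 0 (- S).
    by rewrite tr_block_mx !trmx0 As trmxN Ss.
  have s2 : (block_mx 0 N N^T 0)^T = block_mx 0 N N^T 0.
    by rewrite tr_block_mx !trmx0 trmxK.
  have s12 : block_mx A 0 0 (- S) *m block_mx 0 N N^T 0 = 0.
    by rewrite mulmx_block !(mulmx0, mul0mx, addr0, add0r) AN mulNmx NS oppr0 block_mx_const.
  split.
    rewrite ind_add_ortho// ind_block_diag// ?ind_antidiag ?trmxN ?Ss//.
    by rewrite addnAC.
  rewrite opprD ind_add_ortho ?trmxN ?s1 ?s2//; last first.
    by rewrite mulmxN mulNmx s12 !oppr0.
  rewrite !opp_block_mx !oppr0 opprK ind_block_diag ?trmxN ?As//.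
  by rewrite -trmxN ind_antidiag mxrank_opp addnAC.
rewrite -(@ind_congr _ _ _ (block_mx 1%:M 0 (- K^T) 1%:M) Hs); last first.
  by rewrite unitmxE det_lblock !det1 mulr1 unitr1.
rewrite -(@ind_congr _ _ (- _) (block_mx 1%:M 0 (- K^T) 1%:M)); last first.
- by rewrite unitmxE det_lblock !det1 mulr1 unitr1.
- by rewrite trmxN Hs.
- by rewrite mulmxN mulNmx HE.
Qed.

Variable n : nat.
Implicit Types (Y : 'M[R]_(n + n, n)) (T D : 'M[R]_n).

(** The form with blocks [A], [B], [C] below is evaluated twice: by its generalized Schur
    complement, which produces [comp_M] and [comp_P], and by congruence to diag (D - Dh, Dh). The
    opposite form gives the comparative index, the form itself the dual one. *)
Lemma comp_index_frames Y Yh T Th D Dh :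
  T \in unitmx -> Th \in unitmx -> D^T = D -> Dh^T = Dh ->
  usubmx Y = D *m T -> usubmx Yh = Dh *m Th ->
  wronskian Y Yh = T^T *m (Dh - D) *m Th ->
  (comp_index Y Yh + ind (- D) = ind (Dh - D) + ind (- Dh))%N /\
  (dual_comp_index Y Yh + ind D = ind (D - Dh) + ind Dh)%N.
Proof.
move=> Tu Thu Ds Dhs XE XhE WE.
pose X := usubmx Y; pose W := wronskian Y Yh.
have [MP1 MP2 _ MP4] := moore_penroseP X.
pose Xp := moore_penrose X.
have [A AE] : exists A, A = T^T *m D *m T by eexists.
have [B BE] : exists B, B = T^T *m Dh *m Th by eexists.
have [C CE] : exists C, C = Th^T *m Dh *m Th by eexists.
(* Since [A = T^T *m X], this [g] satisfies [g *m A = Xp *m X], as the Schur complement formula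
   requires. *)
have [g gE] : exists g, g = Xp *m invmx T^T by eexists.
pose Q := 1%:M - Xp *m X.
have As : A^T = A by rewrite AE !trmx_mul trmxK Ds mulmxA.
have Cs : C^T = C by rewrite CE !trmx_mul trmxK Dhs mulmxA.
have Qs : Q^T = Q by rewrite trmxB trmx1 MP4.
have AX : A = T^T *m X by rewrite AE /X XE mulmxA.
have AQ : A *m Q = 0 by rewrite mulmxBr mulmx1 AX -mulmxA [X *m _]mulmxA MP1 subrr.
have QA : Q *m A = 0 by rewrite -Qs -As -trmx_mul AQ trmx0.
have gA : g *m A = 1%:M - Q.
  by rewrite subKr AX gE mulmxA mulmxKV ?unitmx_tr.
have [] := ind_generalized_schur B As Cs Qs QA gA.
(* The Wronskian differs from [B] by [A] times a matrix, which [Q] annihilates. *)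
have WE' : W = B - A *m (invmx T *m Th).
  by rewrite /W WE AE BE mulmxBr mulmxBl !mulmxA mulmxK.
have NE : comp_M Y Yh = Q *m B.
  by rewrite /comp_M -/X -/Xp -/Q -/W WE' mulmxBr mulmxA QA mul0mx subr0.
rewrite -NE -/(comp_V Y Yh).
set V := comp_V Y Yh.
have NV : comp_M Y Yh *m V = 0.
  by have [h _ _ _] := moore_penroseP (comp_M Y Yh); rewrite mulmxBr mulmx1 mulmxA h subrr.
have BV : A *m g^T *m (B *m V) = B *m V.
  have -> : A *m g^T = 1%:M - Q by rewrite -As -trmx_mul gA trmxB trmx1 Qs.
  by rewrite mulmxBl mul1mx mulmxA -NE NV subr0.
have AgA : A *m g *m A = A by rewrite -mulmxA gA mulmxBr mulmx1 AQ subr0.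
(* The columns of [B *m V] lie in the range of [A], where [g] acts as a right inverse; this turns
   the second term of the Wronskian into [C]. *)
have AgBV : A *m (g *m (B *m V)) = B *m V.
  by rewrite -BV !mulmxA AgA -!mulmxA.
have PE : comp_P Y Yh = V *m (B^T *m g *m B - C) *m V.
  rewrite /comp_P -/V -/X -/Xp -/W XhE.
  have -> : Dh *m Th = invmx T^T *m B by rewrite BE -mulmxA mulKmx ?unitmx_tr ?mulmxA.
  rewrite -!mulmxA; congr (_ *m _).
  rewrite mulmxBl -!mulmxA (mulmxA Xp) -gE WE' trmxB mulmxBl; congr (_ - _).
  rewrite trmx_mul As -mulmxA AgBV trmx_mul !mulmxA; congr (_ *m _).
  by rewrite BE CE !mulmxA trmx_inv mulmxKV ?unitmx_tr.
rewrite -PE.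
(* [L] carries diag (D - Dh, Dh) to the matrix with blocks D, Dh, Dh, Dh, and [P] restores the
   factors [T] and [Th]. *)
pose P := block_mx T^T 0 0 Th^T; pose L := block_mx 1%:M 1%:M 0 1%:M : 'M[R]_(n + n).
have Ls : (block_mx (D - Dh) 0 0 Dh)^T = block_mx (D - Dh) 0 0 Dh.
  by rewrite tr_block_mx !trmx0 trmxB Ds Dhs.
have HE : block_mx A B B^T C = (P *m L) *m block_mx (D - Dh) 0 0 Dh *m (P *m L)^T.
  rewrite /P /L mulmx_block !(mulmx0, mul0mx, addr0, add0r, mulmx1).
  rewrite tr_block_mx !mulmx_block !trmx0 !trmxK.
  rewrite !(mulmx0, mul0mx, addr0, add0r) -mulmxDl -mulmxDr subrK AE BE CE.
  by rewrite !trmx_mul !trmxK Dhs !mulmxA.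
have PLu : P *m L \in unitmx.
  rewrite unitmx_mul !unitmxE !det_ublock !det1 mulr1 unitr1 andbT !det_tr.
  by rewrite unitrM -!unitmxE Tu.
have ind_A : ind A = ind D by rewrite AE -[T in X in _ *m X]trmxK ind_congr ?unitmx_tr.
have ind_NA : ind (- A) = ind (- D).
  rewrite AE -mulNmx -mulmxN -[T in X in _ *m X]trmxK ind_congr ?unitmx_tr//.
  by rewrite trmxN Ds.
have DhN : (- Dh)^T = - Dh by rewrite trmxN Dhs.
have DD (E F : 'M[R]_n) : E^T = E -> F^T = F -> (E - F)^T = E - F.
  by move=> Es Fs; rewrite trmxB Es Fs.
have NLs : (- block_mx (D - Dh) 0 0 Dh)^T = - block_mx (D - Dh) 0 0 Dh.
  by rewrite trmxN Ls.
have NHE : - block_mx A B B^T C = (P *m L) *m - block_mx (D - Dh) 0 0 Dh *m (P *m L)^T.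
  by rewrite HE mulmxN mulNmx.
have e1 : ind (block_mx A B B^T C) = (ind (D - Dh) + ind Dh)%N.
  by rewrite HE ind_congr// ind_block_diag// DD.
have e2 : ind (- block_mx A B B^T C) = (ind (Dh - D) + ind (- Dh))%N.
  by rewrite NHE ind_congr// opp_block_mx !oppr0 opprB ind_block_diag// DD.
rewrite e1 e2 ind_A ind_NA => h1 h2.
by split; [rewrite h2|rewrite h1]; rewrite addnC addnA.
Qed.

End StaticIndex.

(** * Limits of matrices and local constancy *)

Section MatrixLimits.
Context {R : realType} {T : Type} {F : set_system T} {FF : Filter F}.

(** Convergence is entrywise, so that products, determinants and inverses reduce to finite sums and
    products of real limits. *)
Definition mxcvg m n (A : T -> 'M[R]_(m, n)) (L : 'M[R]_(m, n)) :=
  forall i j, A x i j @[x --> F] --> L i j.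

Lemma mxcvg_cst m n (L : 'M[R]_(m, n)) : mxcvg (fun=> L) L.
Proof. by move=> i j; exact: cvg_cst. Qed.

Lemma mxcvgB m n (A B : T -> 'M[R]_(m, n)) L K :
  mxcvg A L -> mxcvg B K -> mxcvg (fun x => A x - B x) (L - K).
Proof.
move=> AL BK i j; rewrite !mxE; under eq_cvg do rewrite !mxE.
by apply: cvgB; [exact: AL|exact: BK].
Qed.

Lemma mxcvgZ m n c (A : T -> 'M[R]_(m, n)) L :
  mxcvg A L -> mxcvg (fun x => c *: A x) (c *: L).
Proof.
move=> AL i j; rewrite !mxE; under eq_cvg do rewrite !mxE.
by apply: cvgM; [exact: cvg_cst|exact: AL].
Qed.

Lemma cvg_sumr (I : Type) (r : seq I) (P : pred I) (f : I -> T -> R) (l : I -> R) :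
  (forall i, f i x @[x --> F] --> l i) ->
  \sum_(i <- r | P i) f i x @[x --> F] --> \sum_(i <- r | P i) l i.
Proof. by move=> fl; apply: cvg_big => //; exact: add_continuous. Qed.

Lemma cvg_prodr (I : Type) (r : seq I) (P : pred I) (f : I -> T -> R) (l : I -> R) :
  (forall i, f i x @[x --> F] --> l i) ->
  \prod_(i <- r | P i) f i x @[x --> F] --> \prod_(i <- r | P i) l i.
Proof. by move=> fl; apply: cvg_big => //; exact: mul_continuous. Qed.

Lemma mxcvgM m n p (A : T -> 'M[R]_(m, n)) (B : T -> 'M[R]_(n, p)) L K :
  mxcvg A L -> mxcvg B K -> mxcvg (fun x => A x *m B x) (L *m K).
Proof.
move=> AL BK i j; rewrite !mxE; under eq_cvg do rewrite !mxE.
by apply: cvg_sumr => k; apply: cvgM; [exact: AL|exact: BK].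
Qed.

Lemma cvg_det n (A : T -> 'M[R]_n) L : mxcvg A L -> \det (A x) @[x --> F] --> \det L.
Proof.
move=> AL; rewrite /determinant; apply: cvg_sumr => s.
by apply: cvgM; [exact: cvg_cst|apply: cvg_prodr => i; exact: AL].
Qed.

Lemma near_unitmx n (A : T -> 'M[R]_n) L : mxcvg A L -> L \in unitmx ->
  \forall x \near F, A x \in unitmx.
Proof.
move=> /cvg_det AL; rewrite unitmxE unitfE => L0.
have /cvgr_neq0 := AL; move=> /(_ L0); apply: filterS => x.
by rewrite unitmxE unitfE.
Qed.

Lemma mxcvgV n (A : T -> 'M[R]_n) L : mxcvg A L -> L \in unitmx ->
  mxcvg (fun x => invmx (A x)) (invmx L).
Proof.
move=> AL Lu i j.
(* [invmx] is given by cofactors only at invertible matrices, so the equality is stated near the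
   limit. *)
have near_eq : {near F, (fun x => (\det (A x))^-1 * cofactor (A x) j i) =1
    (fun x => invmx (A x) i j)}.
  apply: filterS (near_unitmx AL Lu) => x Axu.
  by rewrite /invmx Axu !mxE.
apply: cvg_trans (near_eq_cvg near_eq) _.
have -> : invmx L i j = (\det L)^-1 * cofactor L j i by rewrite /invmx Lu !mxE.
apply: cvgM; first by apply: cvgV; [rewrite -unitfE -unitmxE|exact: cvg_det].
rewrite /cofactor; apply: cvgM; first exact: cvg_cst.
apply: cvg_det => k l; rewrite !mxE; under eq_cvg do rewrite !mxE.
exact: AL.
Qed.

(** When the entries of [B *m A x *m B^T + 1%:M] are below 1 / (k + 1), the form exceeds minus the
    squared norm of [v] by at most k / (k + 1) of that norm squared. *)
Lemma negdef_near k n (B : 'M[R]_(k, n)) (A : T -> 'M[R]_n) L :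
  mxcvg A L -> B *m L *m B^T = - 1%:M -> \forall x \near F, negdef_on B (A x).
Proof.
move=> AL BL.
have near_entry : \forall x \near F, forall ij : 'I_k * 'I_k,
    `|(B *m A x *m B^T + 1%:M) ij.1 ij.2| < (k.+1%:R)^-1.
  apply: filter_forall => -[i j] /=.
  have BAB : mxcvg (fun x => B *m A x *m B^T) (B *m L *m B^T).
    by apply: mxcvgM; [apply: mxcvgM => //|]; exact: mxcvg_cst.
  have := BAB i j; rewrite BL => /cvgr_dist_lt /(_ (k.+1%:R)^-1).
  rewrite invr_gt0 ltr0Sn => /(_ isT); apply: filterS => x.
  by rewrite distrC !mxE opprK.
apply: filterS near_entry => x xlt v v0.
set N := _ + _ in xlt.
have -> : (v *m B *m A x *m (v *m B)^T) 0 0 = (v *m N *m v^T) 0 0 - (v *m v^T) 0 0.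
  rewrite trmx_mul !mulmxA -(mulmxA v) -(mulmxA v).
  rewrite (_ : _ *m B^T = N - 1%:M); last by rewrite /N addrK.
  by rewrite mulmxBr mulmx1 mulmxBl [LHS]mxE [X in _ + X]mxE.
have vv0 := mulmxtr_gt0 v0; rewrite subr_lt0.
have vvE : (v *m v^T) 0 0 = \sum_i v 0 i ^+ 2.
  by rewrite mxE; apply: eq_bigr => i _; rewrite mxE expr2.
have le_ij i j : (v 0 i * N i j) * v 0 j <= (k.+1%:R)^-1 * ((v 0 i ^+ 2 + v 0 j ^+ 2) / 2).
  have := xlt (i, j) => /= /ltW Nij.
  have h : `|v 0 i| * `|v 0 j| <= (v 0 i ^+ 2 + v 0 j ^+ 2) / 2.
    rewrite -(real_normK (num_real (v 0 i))) -(real_normK (num_real (v 0 j))).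
    have := sqr_ge0 (`|v 0 i| - `|v 0 j|); nra.
  apply: le_trans (ler_norm _) _; rewrite !normrM mulrAC mulrC.
  by apply: ler_pM => //; rewrite mulr_ge0.
have : (v *m N *m v^T) 0 0 <= (k.+1%:R)^-1 * (k%:R * (v *m v^T) 0 0).
  rewrite mxE; under eq_bigr do rewrite [v^T _ _]mxE [(v *m N) _ _]mxE mulr_suml.
  apply: le_trans (_ : \sum_j \sum_i (k.+1%:R)^-1 * ((v 0 i ^+ 2 + v 0 j ^+ 2) / 2) <= _).
    by apply: ler_sum => j _; apply: ler_sum => i _; exact: le_ij.
  under eq_bigr do rewrite -mulr_sumr -mulr_suml big_split/= -vvE sumr_const card_ord.
  rewrite -mulr_sumr -mulr_suml big_split/= sumr_const card_ord.
  by rewrite sumrMnl -vvE mulrDl -splitr mulr_natl.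
move=> /le_lt_trans; apply; rewrite mulrA gtr_pMl// mulrC ltr_pdivrMr ?ltr0Sn//.
by rewrite mul1r ltr_nat.
Qed.

Lemma ind_near_ge n (A : T -> 'M[R]_n) L : mxcvg A L -> L^T = L ->
  (\forall x \near F, (A x)^T = A x) -> \forall x \near F, (ind L <= ind (A x))%N.
Proof.
move=> AL Ls As; have [k [B [<- BL _]]] := exists_negative_frame Ls.
apply: filterS2 As (negdef_near AL BL) => x Asx; exact: negdef_on_le.
Qed.

(** Both indices are lower semicontinuous and their sum is the constant rank, so neither can
    move. *)
Lemma ind_near_eq n (A : T -> 'M[R]_n) L : mxcvg A L -> L^T = L ->
  (\forall x \near F, (A x)^T = A x) -> (\forall x \near F, \rank (A x) = \rank L) ->
  \forall x \near F, ind (A x) = ind L /\ ind (- A x) = ind (- L).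
Proof.
move=> AL Ls As Ar.
have NAL : mxcvg (fun x => - A x) (- L).
  move=> i j; rewrite mxE; under eq_cvg do rewrite mxE; apply: cvgN; exact: AL.
have NLs : (- L)^T = - L by rewrite trmxN Ls.
have NAs : \forall x \near F, (- A x)^T = - A x.
  by apply: filterS As => x Ax; rewrite trmxN Ax.
apply: filterS3 (filterI As Ar) (ind_near_ge AL Ls As) (ind_near_ge NAL NLs NAs).
move=> x [Asx Arx]; have := indD_rank Asx; rewrite Arx -(indD_rank Ls); lia.
Qed.

End MatrixLimits.

(** * From local to global on a segment *)

Section RealInduction.
Variable R : realType.

(** The supremum of the points reachable from [a] is itself reachable and, unless it is [b], can be
    passed. This serves both for local constancy and for gluing partitions. *)
Lemma segment_chain (a b : R) (P : R -> R -> Prop) : a <= b ->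
  (forall x y z, P x y -> P y z -> P x z) ->
  (forall x, x \in `[a, b] -> exists2 e, 0 < e & forall s t, s \in `[a, b] ->
     t \in `[a, b] -> s <= t -> `|s - x| < e -> `|t - x| < e -> P s t) ->
  P a b.
Proof.
move=> ab Ptrans Ploc.
have aab : a \in `[a, b] by rewrite in_itv/= lexx.
have dist0 (x e : R) : 0 < e -> `|x - x| < e by rewrite subrr normr0.
pose S := [set t | t \in `[a, b] /\ P a t].
have Sa : S a.
  have [e e0 eP] := Ploc a aab.
  by split=> //; apply: eP => //; exact: dist0.
have Sub : ubound S b by move=> t [+ _]; rewrite in_itv/= => /andP[].
have Ssup : has_sup S by split; [exists a|exists b].
pose c := sup S.
have cab : c \in `[a, b].
  by rewrite in_itv/= (ub_le_sup (ex_intro _ _ Sub) Sa)/= sup_le_ub//; exists a.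
have [e e0 eP] := Ploc c cab.
have [t [tab Pat] tc] := sup_adherent e0 Ssup.
have t_le_c : t <= c by apply: (ub_le_sup (ex_intro _ _ Sub)).
have tdist : `|t - c| < e by rewrite distrC ger0_norm ?subr_ge0// ltrBlDr -ltrBlDl.
(* [u] is half a radius beyond [c], cut off at [b]; being reachable it cannot exceed [c], so it must
   be [b]. *)
pose u := Num.min b (c + e / 2).
have cu : c <= u by rewrite le_min lerDl (ltW (divr_gt0 e0 _))// andbT; move: cab; rewrite in_itv/= => /andP[].
have uab : u \in `[a, b].
  rewrite in_itv/= ge_min lexx/= andbT (le_trans _ cu)//.
  by move: cab; rewrite in_itv/= => /andP[].
have udist : `|u - c| < e.
  rewrite ger0_norm ?subr_ge0// ltrBlDr; apply: le_lt_trans (_ : c + e / 2 < _).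
    by rewrite ge_min lexx orbT.
  lra.
have Su : S u.
  split=> //; apply: Ptrans Pat _; apply: eP => //; exact: le_trans cu.
have uc : u <= c by apply: (ub_le_sup (ex_intro _ _ Sub)).
have [ub|ub] := leP b (c + e / 2).
  by have := Su.2; rewrite /u /Num.min; case: ltgtP ub => // ->.
have uE : u = c + e / 2 by rewrite /u minEle leNgt ub.
by move: uc; rewrite uE; lra.
Qed.

Lemma near_within_itv (a b x : R) (Q : R -> Prop) :
  (\forall t \near within [set` `[a, b]] (nbhs x), Q t) ->
  exists2 e, 0 < e & forall t, t \in `[a, b] -> `|t - x| < e -> Q t.
Proof.
move=> /nbhs_ballP[e /= e0 eQ]; exists e => // t tab tx.
by apply: eQ => //; rewrite /ball/= distrC.
Qed.

Lemma locally_constant_itv (T : Type) (a b : R) (f : R -> T) : a <= b ->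
  (forall x, x \in `[a, b] ->
     \forall t \near within [set` `[a, b]] (nbhs x), f t = f x) -> f a = f b.
Proof.
move=> ab floc; pose P s t := f s = f t; rewrite -/(P a b).
apply: segment_chain => // [x y z|x xab]; first by rewrite /P => ->.
have [e e0 eP] := near_within_itv (floc x xab).
by exists e => // s t sab tab _ sx tx; rewrite /P (eP s)// (eP t).
Qed.

End RealInduction.

(** * Lagrangian planes and Lidskii angles *)

Section LagrangianPencil.
Variables (R : realType) (n : nat).
Implicit Types (Y Yh : 'M[R]_(n + n, n)) (x : R).

(** When [pencil x Y] is invertible and [D = frame x Y], the plane [Y] is the column with blocks D
    and x D - 1, times [pencil x Y]. *)
Definition pencil x Y := x *: usubmx Y - dsubmx Y.
Definition frame x Y := usubmx Y *m invmx (pencil x Y).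

Lemma wronskianE Y Yh :
  wronskian Y Yh = (usubmx Y)^T *m dsubmx Yh - (dsubmx Y)^T *m usubmx Yh.
Proof.
rewrite /wronskian /Jmx -{1}[Y]vsubmxK -{1}[Yh]vsubmxK tr_col_mx mul_row_block mul_row_col.
by rewrite !mulmx0 add0r addr0 mulmx1 mulmxN mulmx1 mulNmx addrC.
Qed.

Lemma lagrangian_tr_sym Y : lagrangian_plane Y ->
  (usubmx Y)^T *m dsubmx Y = (dsubmx Y)^T *m usubmx Y.
Proof. by case; rewrite -/(wronskian Y Y) wronskianE => /eqP; rewrite subr_eq0 => /eqP. Qed.

Lemma gram_unitmx m k (Z : 'M[R]_(m, k)) : \rank Z = k -> Z^T *m Z \in unitmx.
Proof.
move=> Zk; rewrite -row_free_unit -kermx_eq0; apply/rowV0P => v /sub_kermxP vZ.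
have Zfree : row_free Z^T by rewrite -row_leq_rank mxrank_tr Zk.
apply/eqP; rewrite -(mulmx_free_eq0 v Zfree) -mulmxtr_eq0 trmx_mul trmxK.
by rewrite mulmxA -(mulmxA v) vZ mul0mx mxE.
Qed.

Lemma gramE Y : Y^T *m Y = (usubmx Y)^T *m usubmx Y + (dsubmx Y)^T *m dsubmx Y.
Proof. by rewrite -{1 2}[Y]vsubmxK tr_col_mx mul_row_col. Qed.

Lemma complexmxM k (A B : 'M[R]_k) : complexmx (A *m B) = complexmx A *m complexmx B.
Proof. exact: map_mxM. Qed.

Lemma complexmxD k (A B : 'M[R]_k) : complexmx (A + B) = complexmx A + complexmx B.
Proof. exact: map_mxD. Qed.

Lemma complexmx_unit k (A : 'M[R]_k) : A \in unitmx -> complexmx A \in unitmx.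
Proof. by rewrite map_unitmx. Qed.

(** Left multiplication by U^T + i X^T gives the invertible Gram matrix of [Y]; the mixed terms
    cancel because X^T U is symmetric. *)
Lemma lagrangian_complex_unitmx Y : lagrangian_plane Y ->
  complexmx (dsubmx Y) - 'i%C *: complexmx (usubmx Y) \in unitmx.
Proof.
move=> YL; have Ysym := lagrangian_tr_sym YL; case: YL => _ rY.
set X := usubmx Y in Ysym *; set U := dsubmx Y in Ysym *.
have := complexmx_unit (gram_unitmx rY); rewrite gramE -/X -/U.
have -> : complexmx (X^T *m X + U^T *m U) =
  (complexmx U^T + 'i%C *: complexmx X^T) *m (complexmx U - 'i%C *: complexmx X).
  rewrite mulmxBr !mulmxDl -!(scalemxAl, scalemxAr) -!complexmxM Ysym complexmxD.
  by rewrite scalerA -expr2 sqr_i scaleN1r opprD opprK addrA addrK addrC.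
by rewrite unitmx_mul => /andP[].
Qed.

(** The polynomial is nonzero because its value at i is, up to sign, the determinant of U - i X. *)
Lemma pencil_poly Y : lagrangian_plane Y -> exists2 p : {poly R}, p != 0 &
  forall x, p.[x] = \det (pencil x Y).
Proof.
move=> YL; set X := usubmx Y; set U := dsubmx Y.
exists (\det ('X *: map_mx polyC X - map_mx polyC U)); last first.
  move=> x; rewrite -horner_evalE -det_map_mx; congr (\det _).
  apply/matrixP => i j.
  by rewrite !mxE /= /horner_eval !(hornerE, mxE).
apply/eqP => p0.
have := lagrangian_complex_unitmx YL; rewrite unitmxE unitfE -/X -/U => /eqP; apply.
have : (map_poly (real_complex R) (\det ('X *: map_mx polyC X - map_mx polyC U))).['i%C] = 0.
  by rewrite p0 rmorph0 horner0.
rewrite -horner_evalE -!det_map_mx -map_mx_comp.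
rewrite (_ : complexmx U - _ = -1 *: ('i%C *: complexmx X - complexmx U)); last first.
  by rewrite scaleN1r opprB.
rewrite detZ => dE.
rewrite (_ : _ - _ = map_mx (horner_eval 'i%C \o map_poly (real_complex R)) ('X *: map_mx polyC X - map_mx polyC U)) ?dE ?mulr0//.
by apply/matrixP => i j; rewrite !mxE /= /horner_eval rmorphB rmorphM/= map_polyX !map_polyC !hornerE.
Qed.

Lemma exists_pencil_unitmx Y Yh : lagrangian_plane Y -> lagrangian_plane Yh ->
  exists x, pencil x Y \in unitmx /\ pencil x Yh \in unitmx.
Proof.
move=> /pencil_poly[p p0 pE] /pencil_poly[ph ph0 phE].
have pph0 : p * ph != 0 by rewrite mulf_neq0.
(* No root of the product lies at or beyond its Cauchy bound, so neither determinant vanishes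
   there. *)
exists (cauchy_bound (p * ph)).
have := @ge_cauchy_bound R _ pph0 (cauchy_bound (p * ph)).
rewrite in_itv/= lexx => /(_ isT); rewrite rootE hornerM mulf_eq0 negb_or.
by rewrite pE phE !unitmxE !unitfE => /andP.
Qed.

Section Frame.
Variables (x : R) (Y : 'M[R]_(n + n, n)).
Hypotheses (YL : lagrangian_plane Y) (Tu : pencil x Y \in unitmx).
Let T := pencil x Y.
Let D := frame x Y.

Lemma frame_usubmx : usubmx Y = D *m T.
Proof. by rewrite /D /frame mulmxKV. Qed.

Lemma frame_dsubmx : dsubmx Y = (x *: D - 1%:M) *m T.
Proof.
by rewrite mulmxBl mul1mx -scalemxAl -frame_usubmx /T /pencil opprB addrC subrK.
Qed.

Lemma frame_sym : D^T = D.
Proof.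
have TX : T^T *m usubmx Y = (usubmx Y)^T *m T.
  rewrite /T /pencil trmxB mulmxBl mulmxBr (lagrangian_tr_sym YL).
  by rewrite linearZ/= -scalemxAl -scalemxAr.
have Ttu : T^T \in unitmx by rewrite unitmx_tr.
rewrite /D /frame -[usubmx Y in RHS](mulKmx Ttu) TX.
by rewrite mulmxA mulmxK// trmx_mul trmx_inv.
Qed.

End Frame.

(** The middle factor is D (x Dh - 1) - (x D - 1) Dh, in which the terms in x cancel. *)
Lemma frame_wronskian x Y Yh : lagrangian_plane Y -> lagrangian_plane Yh ->
  pencil x Y \in unitmx -> pencil x Yh \in unitmx ->
  wronskian Y Yh = (pencil x Y)^T *m (frame x Yh - frame x Y) *m pencil x Yh.
Proof.
move=> YL YhL Tu Thu; rewrite wronskianE.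
rewrite [dsubmx Y in LHS](frame_dsubmx Tu) [dsubmx Yh in LHS](frame_dsubmx Thu).
rewrite [usubmx Y in LHS](frame_usubmx Tu) [usubmx Yh in LHS](frame_usubmx Thu).
move: (pencil x Y) (pencil x Yh) => T Th.
have := frame_sym YL Tu; have := frame_sym YhL Thu.
move: (frame x Y) (frame x Yh) => D Dh Dhs Ds.
rewrite !trmx_mul trmxB linearZ/= Ds trmx1 !mulmxA -mulmxBl; congr (_ *m _).
rewrite -!mulmxA -mulmxBr; congr (_ *m _).
rewrite mulmxBr mulmxBl mulmx1 mul1mx -scalemxAl -scalemxAr.
by rewrite opprB addrC addrA subrK.
Qed.

End LagrangianPencil.

(** * The spectrum of the Lidskii matrix *)

Section LidskiiCount.
Variables (R : realType) (n : nat).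
Implicit Types (Y : 'M[R]_(n + n, n)) (x : R).

(** The spectral theorem provides an inverse square root, so the default 0 of [xget] is excluded;
    any matrix whose square is invertible is invertible. *)
Lemma invsqrtmx_unitmx m k (Z : 'M[R]_(m, k)) : \rank Z = k ->
  invsqrtmx (Z^T *m Z) \in unitmx.
Proof.
move=> Zk; have Gu := gram_unitmx Zk.
have Gs : (Z^T *m Z)^T = Z^T *m Z by rewrite trmx_mul trmxK.
have [P [d [PP GE]]] := real_spectral Gs; have PP' := mulmx1C PP.
have Pu : P \in unitmx by have [] := mulmx1_unit PP.
have PZfree : row_free (P *m Z^T).
  by rewrite /row_free eqmxMfull ?row_full_unit// mxrank_tr Zk.
have d_gt0 j : 0 < d 0 j.
  have -> : d 0 j = (row j (P *m Z^T) *m (row j (P *m Z^T))^T) 0 0.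
    have -> : d 0 j = (P *m Z^T *m (P *m Z^T)^T) j j.
      rewrite trmx_mul trmxK -mulmxA (mulmxA Z^T) GE !mulmxA PP mul1mx -mulmxA PP mulmx1.
      by rewrite mxE eqxx mulr1n.
    by rewrite !mxE; apply: eq_bigr => l _; rewrite !mxE.
  apply: mulmxtr_gt0; rewrite rowE mulmx_free_eq0//.
  by apply/eqP => /matrixP/(_ 0 j)/eqP; rewrite !mxE !eqxx oner_eq0.
pose e : 'rV[R]_k := \row_j (Num.sqrt (d 0 j))^-1.
rewrite /invsqrtmx; case: xgetP => [K _ [_ KK]|/(_ (P^T *m diag_mx e *m P))].
  by have : K *m K \in unitmx; [rewrite KK unitmx_inv|rewrite unitmx_mul => /andP[]].
case; split; first split.
- by rewrite !trmx_mul trmxK tr_diag_mx mulmxA.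
- move=> v v0; have w0 : v^T *m P^T != 0.
    rewrite mulmx_free_eq0 ?row_free_unit ?unitmx_tr//.
    by apply: contra v0 => /eqP vt0; rewrite -[v]trmxK vt0 trmx0.
  have -> : v^T *m (P^T *m diag_mx e *m P) *m v =
      (v^T *m P^T) *m diag_mx e *m (v^T *m P^T)^T.
    by rewrite [(v^T *m P^T)^T]trmx_mul !trmxK !mulmxA.
  have ge0 l : 0 <= e 0 l * (v^T *m P^T) 0 l * (v^T *m P^T) 0 l.
    by rewrite -mulrA -expr2 mulr_ge0 ?sqr_ge0// mxE invr_ge0 sqrtr_ge0.
  rewrite mulmx_diag_quad lt_def sumr_ge0 ?andbT//.
  apply: contra w0; rewrite psumr_eq0// => /allP h; apply/eqP/rowP => l.
  have /eqP := h l (mem_index_enum _); rewrite -mulrA -expr2 => /eqP.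
  rewrite mulf_eq0 sqrf_eq0 [e 0 l]mxE invr_eq0 sqrtr_eq0 leNgt d_gt0/= => /eqP ->.
  by rewrite mxE.
- have diagM (y z : 'rV[R]_k) : P^T *m diag_mx y *m P *m (P^T *m diag_mx z *m P) =
      P^T *m diag_mx (\row_j (y 0 j * z 0 j)) *m P.
    by rewrite !mulmxA -(mulmxA _ P) PP mulmx1 -(mulmxA P^T) mulmx_diag.
  apply: (can_inj (mulKmx Gu)); rewrite mulmxV// GE !diagM.
  transitivity (P^T *m diag_mx (const_mx 1) *m P); last by rewrite diag_const_mx mulmx1.
  congr (_ *m diag_mx _ *m _); apply/rowP => j; rewrite !mxE.
  by rewrite -invfM -expr2 sqr_sqrtr ?ltW// divff// gt_eqF.
Qed.

Definition mobius x (d : R) : R[i] :=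
  (((x +i* 1) * d%:C - 1) / ((x +i* (-1)) * d%:C - 1))%C.

Lemma quad_neq0 x d : (x * d - 1) ^+ 2 + d ^+ 2 != 0.
Proof.
rewrite paddr_eq0 ?sqr_ge0// !sqrf_eq0; apply/negP => /andP[/eqP h /eqP d0].
by move: h; rewrite d0 mulr0 sub0r => /eqP; rewrite oppr_eq0 oner_eq0.
Qed.

Lemma mobius_den_neq0 x d : ((x +i* (-1)) * d%:C - 1 != 0)%C.
Proof.
rewrite eq_complex /= !(mulr0, mul0r, subr0, add0r, addr0, mulN1r, oppr0) oppr_eq0.
by apply/negP => /andP[/eqP h /eqP d0]; move: h; rewrite d0 mulr0 sub0r => /eqP; rewrite oppr_eq0 oner_eq0.
Qed.

Lemma mobiusE x d : mobius x d =
  (((x * d - 1) ^+ 2 - d ^+ 2) / ((x * d - 1) ^+ 2 + d ^+ 2) +i*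
   (2 * d * (x * d - 1) / ((x * d - 1) ^+ 2 + d ^+ 2)))%C.
Proof.
have N0 := quad_neq0 x d.
apply: (mulIf (mobius_den_neq0 x d)); rewrite /mobius divfK ?mobius_den_neq0//.
by apply/eqP; rewrite eq_complex /=; apply/andP; split; apply/eqP; field.
Qed.

(** Its zero set is the line through 1 and exp (2 i al), where [x] is the cotangent of [al]; the
    sign separates the two arcs of the unit circle. *)
Definition side x (z : R[i]) : R := x * complex.Re z + complex.Im z - x.

Lemma side_mobius x d : side x (mobius x d) = - (2 * d) / ((x * d - 1) ^+ 2 + d ^+ 2).
Proof.
have N0 := quad_neq0 x d.
by rewrite mobiusE /side /=; field.
Qed.

(** The upper blocks of [Zmx Y] are U K and X K, and U +/- i X = ((x +/- i) D - 1) T. So T K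
    conjugates the Lidskii matrix to a function of D, which [O] diagonalizes. *)
Lemma char_poly_lidskii x Y (O : 'M[R]_n) (d : 'rV[R]_n) :
  lagrangian_plane Y -> pencil x Y \in unitmx ->
  O *m O^T = 1%:M -> frame x Y = O^T *m diag_mx d *m O ->
  char_poly (lidskii_mx (Zmx Y)) = \prod_j ('X - (mobius x (d 0 j))%:P).
Proof.
move=> YL Tu OO DE.
have Ku : invsqrtmx (Y^T *m Y) \in unitmx by apply: invsqrtmx_unitmx; case: YL.
rewrite /lidskii_mx /Zmx; set K := invsqrtmx _ in Ku *.
have -> : row_mx (Jmx R n *m Y *m K) (Y *m K) =
    block_mx (dsubmx Y *m K) (usubmx Y *m K) (- usubmx Y *m K) (dsubmx Y *m K).
  rewrite block_mxEh -!mul_col_mx vsubmxK -{1}[Y]vsubmxK mul_block_col.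
  by rewrite !mul0mx mul1mx mulNmx mul1mx addr0 add0r.
rewrite block_mxKul block_mxKur.
have dE := frame_dsubmx Tu; have uE := frame_usubmx Tu.
move: (frame x Y) (pencil x Y) DE dE uE Tu => D T DE dE uE Tu.
pose CO := complexmx O; pose COt := complexmx O^T.
have COO : CO *m COt = 1%:M by rewrite -complexmxM OO /complexmx map_mx1.
have COO' := mulmx1C COO.
have CDE : complexmx D = COt *m diag_mx (map_mx (real_complex R) d) *m CO.
  by rewrite DE !complexmxM /complexmx map_diag_mx.
have pencilE (e : R) : complexmx (dsubmx Y) + (0 +i* e)%C *: complexmx (usubmx Y) =
   COt *m diag_mx (\row_j ((x +i* e)%C * (d 0 j)%:C%C - 1)) *m CO *m complexmx T.
  rewrite dE uE !complexmxM.
  rewrite scalemxAl -mulmxDl; congr (_ *m _).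
  have -> : complexmx (x *: D - 1%:M) = x%:C%C *: complexmx D - 1%:M.
    by rewrite /complexmx map_mxB map_mxZ map_mx1.
  have -> : 1%:M = COt *m 1%:M *m CO by rewrite mulmx1.
  rewrite addrAC -scalerDl CDE scalemxAl scalemxAr -mulmxBl -mulmxBr; congr (_ *m _ *m _).
  have -> : (x%:C + (0 +i* e) = x +i* e)%C by apply/eqP; rewrite eq_complex/= addr0 add0r !eqxx.
  apply/matrixP => i j; rewrite !mxE mulrnBl; case: eqP => [->|_]; last by rewrite !mulr0n mulr0.
  by rewrite !mulr1n.
pose Q := CO *m complexmx T *m complexmx K.
pose P := invmx (complexmx K) *m invmx (complexmx T) *m COt.
have CTu : complexmx T \in unitmx := complexmx_unit Tu.
have CKu : complexmx K \in unitmx := complexmx_unit Ku.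
have QP : Q *m P = 1%:M.
  by rewrite /Q /P !mulmxA mulmxK// mulmxK.
have -> : invmx (complexmx (dsubmx Y *m K) - 'i%C *: complexmx (usubmx Y *m K)) *m
    (complexmx (dsubmx Y *m K) + 'i%C *: complexmx (usubmx Y *m K)) =
    P *m diag_mx (\row_j mobius x (d 0 j)) *m Q.
  have iE e : complexmx (dsubmx Y *m K) + (0 +i* e)%C *: complexmx (usubmx Y *m K) =
      COt *m diag_mx (\row_j ((x +i* e)%C * (d 0 j)%:C%C - 1)) *m Q.
    by rewrite !complexmxM scalemxAl -mulmxDl pencilE !mulmxA.
  have -> : - ('i%C *: complexmx (usubmx Y *m K)) = (0 +i* (-1))%C *: complexmx (usubmx Y *m K).
    by rewrite -scaleNr; congr (_ *: _); apply/eqP; rewrite eq_complex/= oppr0 !eqxx.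
  clearbody P Q; rewrite !iE; set M := COt *m _ *m Q.
  have Mu : M \in unitmx.
    have [Qu _] := mulmx1_unit QP; have [_ COtu] := mulmx1_unit COO.
    rewrite /M unitmx_mul Qu andbT unitmx_mul COtu/= unitmxE det_diag unitfE.
    by apply/prodf_neq0 => j _; rewrite mxE mobius_den_neq0.
  apply: (can_inj (mulKmx Mu)); rewrite mulKVmx// /M.
  rewrite !mulmxA -(mulmxA _ Q P) QP mulmx1 -(mulmxA COt (diag_mx _) (diag_mx _)) mulmx_diag.
  congr (_ *m diag_mx _ *m _); apply/rowP => j; rewrite !mxE /mobius.
  by rewrite [RHS]mulrC divfK// mobius_den_neq0.
rewrite char_poly_similar// char_poly_trig ?diag_mx_is_trig//.
by apply: eq_bigr => j _; rewrite !mxE eqxx mulr1n.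
Qed.

(** Equal factorizations have the same roots up to order, and [side] has the sign opposite to that
    of the eigenvalue of the frame. It vanishes only for the eigenvalue 0, whose Moebius image is
    1. *)
Lemma lidskii_angles_count x Y (phi : 'I_n -> R) :
  lagrangian_plane Y -> pencil x Y \in unitmx -> lidskii_angles (Zmx Y) phi ->
  [/\ (\sum_j (0 < side x (expi (phi j)))%R)%N = ind (frame x Y),
      (\sum_j (side x (expi (phi j)) < 0)%R)%N = ind (- frame x Y)
    & forall j, side x (expi (phi j)) = 0 -> cos (phi j) = 1].
Proof.
move=> YL Tu; have [P [d [PP DE]]] := real_spectral (frame_sym YL Tu).
rewrite /lidskii_angles (char_poly_lidskii YL Tu PP DE) => charE.
have N_gt0 e : 0 < ((x * e - 1) ^+ 2 + e ^+ 2)^-1.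
  by rewrite invr_gt0 lt_def quad_neq0 addr_ge0 ?sqr_ge0.
have side0 e : (side x (mobius x e) < 0) = (0 < e).
  by rewrite side_mobius mulNr oppr_lt0 pmulr_lgt0// pmulr_rgt0.
have side1 e : (0 < side x (mobius x e)) = (e < 0).
  by rewrite side_mobius pmulr_lgt0// oppr_gt0 pmulr_rlt0.
have pE : perm_eq [seq mobius x (d 0 j) | j <- index_enum 'I_n] [seq expi (phi j) | j <- index_enum 'I_n].
  by apply: prod_XsubC_eq; rewrite !big_map.
split.
- have := perm_big _ pE (op := addn) (x := 0%N) (P := predT) (F := fun z : R[i] => (0 < side x z)%R : nat).
  rewrite !big_map => <-; rewrite DE ind_diag//.
  by apply: eq_bigr => j _; rewrite side1.
- have := perm_big _ pE (op := addn) (x := 0%N) (P := predT) (F := fun z : R[i] => (side x z < 0)%R : nat).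
  rewrite !big_map => <-.
  have -> : - frame x Y = P^T *m diag_mx (- d) *m P by rewrite DE raddfN/= mulmxN mulNmx.
  rewrite ind_diag//; apply: eq_bigr => j _; rewrite side0 mxE oppr_lt0//.
- move=> j; have : expi (phi j) \in [seq mobius x (d 0 k) | k <- index_enum 'I_n].
    by rewrite (perm_mem pE); apply/mapP; exists j; rewrite ?mem_index_enum.
  move=> /mapP[k _ jk]; rewrite jk => sk.
  have dk0 : d 0 k = 0.
    by apply/eqP; rewrite eq_le !leNgt -(side0 (d 0 k)) -(side1 (d 0 k)) sk ltxx.
  have : complex.Re (expi (phi j)) = 1.
    by rewrite jk mobiusE/= dk0 mulr0 sub0r expr0n/= subr0 addr0 divff// sqrrN expr1n oner_eq0.
  by [].
Qed.

End LidskiiCount.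

(** * Local constancy along admissible systems *)

Section Angles.
Variable R : realType.
Implicit Types (x al phi psi : R).

Lemma exists_cotangent x : exists al, [/\ 0 < al, al < pi & cos al = x * sin al].
Proof.
have c0 := cos_atan x.
have cgt0 : 0 < cos (atan x) by rewrite c0 invr_gt0 sqrtr_gt0 ltr_pwDl// sqr_ge0.
exists (pi / 2 - atan x); split.
- by rewrite subr_gt0 atan_ltpi2.
- by have := atan_gtNpi2 x; lra.
- rewrite cosB sinB cos_pihalf sin_pihalf !mul0r !mul1r add0r subr0.
  by rewrite -{2}(atanK x) /tan divfK// gt_eqF.
Qed.

Lemma expi_periodic phi (m : int) : expi (phi - 2 * pi * m%:~R) = expi phi.
Proof.
have pE (k : nat) (y : R) : cos (y + 2 * pi * k%:R) = cos y /\ sin (y + 2 * pi * k%:R) = sin y.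
  have -> : 2 * pi * k%:R = (pi *+ 2) *+ k :> R by rewrite mulr_natr mulr_natl.
  by rewrite (periodicn (@cosD2pi R)) (periodicn (@sinD2pi R)).
rewrite /expi; case: m => k.
  have [c s] := pE k (phi - 2 * pi * k%:R); rewrite -pmulrn.
  by rewrite -c -s subrK.
have [c s] := pE k.+1 phi.
by rewrite NegzE mulrNz mulrN opprK -pmulrn c s.
Qed.

Lemma side_expi x al psi : cos al = x * sin al ->
  sin al * side x (expi psi) = - (2 * sin (psi / 2) * sin (psi / 2 - al)).
Proof.
move=> xE; rewrite /side /=.
have psiE : psi = psi / 2 + psi / 2 by rewrite -splitr.
rewrite {1 2}psiE cosD sinD sinB.
move: xE (sin2cos2 (psi / 2)); move: (cos _) (sin _) (cos _) (sin _) => c s cp sp.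
move=> -> h; have -> : c * c = 1 - s * s by rewrite -!expr2 h; ring.
by ring.
Qed.

(** In this window [psi / 2 - al] lies in (- pi, 0) and [psi / 2] in (- pi, pi), so the product
    formula of [side_expi] leaves the sign of [psi]. *)
Lemma side_expi_sign x al psi : 0 < al -> al < pi -> cos al = x * sin al ->
  2 * al - 2 * pi < psi -> psi < 2 * al ->
  (0 < side x (expi psi)) = (0 < psi) /\ (side x (expi psi) < 0) = (psi < 0).
Proof.
move=> al0 alpi xE psi1 psi2.
have sal : 0 < sin al by rewrite sin_gt0_pi// al0.
have sE := side_expi psi xE.
have s2 : sin (psi / 2 - al) < 0.
  by rewrite -oppr_gt0 -sinN sin_gt0_pi// opprB; lra.
have -> : (0 < side x (expi psi)) = (0 < sin (psi / 2)).
  by rewrite -(pmulr_rgt0 _ sal) sE oppr_gt0 nmulr_llt0// pmulr_rgt0.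
have -> : (side x (expi psi) < 0) = (sin (psi / 2) < 0).
  by rewrite -(pmulr_rlt0 _ sal) sE oppr_lt0 nmulr_lgt0// pmulr_rlt0.
case: (ltgtP psi 0) => [p|p|->].
- have : 0 < sin (- (psi / 2)) by rewrite sin_gt0_pi//; lra.
  by rewrite sinN oppr_gt0 => s; rewrite s ltNge ltW.
- have s : 0 < sin (psi / 2) by rewrite sin_gt0_pi//; lra.
  by rewrite s [X in _ /\ X = _]ltNge ltW.
- by rewrite mul0r sin0 ltxx.
Qed.

(** Reduction modulo 2 pi gives the window closed on the left. At that endpoint [side] vanishes
    although the cosine, cos (2 al), is not 1, so it is excluded. *)
Lemma angle_window x al phi : 0 < al -> al < pi -> cos al = x * sin al ->
  (side x (expi phi) = 0 -> cos phi = 1) ->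
  exists m : int, 2 * al - 2 * pi < phi - 2 * pi * m%:~R < 2 * al.
Proof.
move=> al0 alpi xE sphi.
have pi2 : 0 < 2 * pi :> R by rewrite mulr_gt0// pi_gt0.
pose k := Num.floor ((phi - 2 * al) / (2 * pi)).
have /andP[] := floor_itv ((phi - 2 * al) / (2 * pi)); rewrite -/k.
rewrite ler_pdivlMr// ltr_pdivrMr// intrD => k1 k2; exists (k + 1); rewrite intrD.
apply/andP; split; last by lra.
rewrite lt_neqAle; apply/andP; split; last by lra.
apply/eqP => phiE.
have eE : expi phi = expi (2 * al).
  by rewrite -(expi_periodic phi k); congr expi; lra.
have : side x (expi phi) = 0.
  have sal : 0 < sin al by rewrite sin_gt0_pi// al0.
  apply: (mulfI (lt0r_neq0 sal)); rewrite eE (side_expi _ xE) mulr0.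
  by rewrite (_ : 2 * al / 2 - al = 0) ?sin0 ?mulr0 ?oppr0//; lra.
move=> /sphi; have -> : cos phi = complex.Re (expi phi) by [].
rewrite eE /= => c2; have sal : 0 < sin al by rewrite sin_gt0_pi// al0.
have := sin2cos2 al; have := cosD al al; have := exprn_gt0 2 sal.
rewrite -[al + al](_ : 2 * al = _); last by lra.
by rewrite c2 !expr2; nra.
Qed.

(** [phi - 2 * pi * m] lies strictly between -2 pi and 2 pi, so its sign, read off from [side],
    decides between [m] and [m - 1]; the value 0 belongs to [m]. *)
Lemma floor_window x al phi (m q : int) : 0 < al -> al < pi -> cos al = x * sin al ->
  2 * al - 2 * pi < phi - 2 * pi * m%:~R < 2 * al ->
  2 * pi * q%:~R <= phi < 2 * pi * (q + 1)%:~R ->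
  q = m - ((side x (expi phi) < 0)%R : nat)%:Z.
Proof.
move=> al0 alpi xE /andP[m1 m2] /andP[q1 q2].
have pi2 : 0 < 2 * pi :> R by rewrite mulr_gt0// pi_gt0.
have [_ ] := side_expi_sign al0 alpi xE m1 m2; rewrite expi_periodic => ->.
have lt_int (u v : int) : 2 * pi * u%:~R < 2 * pi * v%:~R :> R -> u < v.
  by rewrite ltr_pM2l// ltr_int.
have h1 : q < m + 1 by apply: lt_int; rewrite intrD; lra.
have h2 : m - 1 < q + 1 by apply: lt_int; rewrite !intrD in q2 *; lra.
case: ltP => h.
- have h3 : q < m by apply: lt_int; lra.
  by lia.
- have h3 : m < q + 1 by apply: lt_int; rewrite !intrD in q2 *; lra.
  by lia.
Qed.

(** With intervals closed on the right, the value 0 of [phi - 2 * pi * m] belongs to [m - 1]; hence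
    the positive sign is the one counted. *)
Lemma ceil_window x al phi (m q : int) : 0 < al -> al < pi -> cos al = x * sin al ->
  2 * al - 2 * pi < phi - 2 * pi * m%:~R < 2 * al ->
  2 * pi * q%:~R < phi <= 2 * pi * (q + 1)%:~R ->
  q = m - 1 + ((0 < side x (expi phi))%R : nat)%:Z.
Proof.
move=> al0 alpi xE /andP[m1 m2] /andP[q1 q2].
have pi2 : 0 < 2 * pi :> R by rewrite mulr_gt0// pi_gt0.
have [] := side_expi_sign al0 alpi xE m1 m2; rewrite expi_periodic => -> _.
have lt_int (u v : int) : 2 * pi * u%:~R < 2 * pi * v%:~R :> R -> u < v.
  by rewrite ltr_pM2l// ltr_int.
have h1 : q < m + 1 by apply: lt_int; rewrite intrD; lra.
have h2 : m - 1 < q + 1 by apply: lt_int; rewrite !intrD in q2 *; lra.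
case: ltP => h.
- have h3 : m < q + 1 by apply: lt_int; rewrite !intrD in q2 *; lra.
  by lia.
- have h3 : q < m by apply: lt_int; lra.
  by lia.
Qed.

End Angles.

Lemma subz_transfer (a b u v : nat) (S : int) : (a + u = b + v)%N ->
  a%:Z - (S - u%:Z) = b%:Z - (S - v%:Z).
Proof. by lia. Qed.

Lemma addz_transfer (a b u v : nat) (S : int) : (a + u = b + v)%N ->
  a%:Z + (S + u%:Z) = b%:Z + (S + v%:Z).
Proof. by lia. Qed.

(** * Comparative index and Lidskii angles near a point *)

Section LocalConstancy.
Variables (R : realType) (n : nat).
Implicit Types (Y Yh : R -> 'M[R]_(n + n, n)) (c d : R).

Lemma mxcvg_continuous m k c d (A : R -> 'M[R]_(m, k)) t0 : t0 \in `[c, d] ->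
  {within `[c, d], continuous A} ->
  mxcvg (F := within [set` `[c, d]] (nbhs t0)) A (A t0).
Proof.
move=> t0cd /subspace_continuousP/(_ t0 t0cd) cA i j.
exact: (cvg_comp _ _ cA (@coord_continuous _ _ _ i j (A t0))).
Qed.

Lemma rank_wronskianC (Y Yh : 'M[R]_(n + n, n)) :
  \rank (wronskian Y Yh) = \rank (wronskian Yh Y).
Proof.
rewrite -mxrank_tr (_ : _^T = - wronskian Yh Y) ?mxrank_opp// !wronskianE.
by rewrite trmxB !trmx_mul !trmxK opprB.
Qed.

Section At.
Variables (c d : R) (Y Yh : R -> 'M[R]_(n + n, n)).
Variables (phi : 'I_n -> R -> R) (q qs : 'I_n -> R -> int).
Hypotheses (cY : {within `[c, d], continuous Y}) (cYh : {within `[c, d], continuous Yh}).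
Hypothesis YL : forall t, t \in `[c, d] -> lagrangian_plane (Y t).
Hypothesis YhL : forall t, t \in `[c, d] -> lagrangian_plane (Yh t).
Hypothesis rW : forall t u, t \in `[c, d] -> u \in `[c, d] ->
  \rank (wronskian (Yh t) (Y t)) = \rank (wronskian (Yh u) (Y u)).
Hypothesis rX : forall t u, t \in `[c, d] -> u \in `[c, d] ->
  \rank (usubmx (Yh t)) = \rank (usubmx (Yh u)).
Hypothesis cphi : forall j, {within `[c, d], continuous (phi j)}.
Hypothesis phiE : forall t, t \in `[c, d] -> lidskii_angles (Zmx (Y t)) (phi ^~ t).
Hypothesis hq : forall j t, t \in `[c, d] ->
  2 * pi * (q j t)%:~R <= phi j t < 2 * pi * (q j t + 1)%:~R.
Hypothesis hqs : forall j t, t \in `[c, d] ->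
  2 * pi * (qs j t)%:~R < phi j t <= 2 * pi * (qs j t + 1)%:~R.

(** The invariants: ind (- D) enters the index and the sum of the [q j] with the same sign, ind D
    enters the dual index and the sum of the [qs j] with opposite signs. *)
Let f t : int := (comp_index (Y t) (Yh t))%:Z - \sum_j q j t.
Let g t : int := (dual_comp_index (Y t) (Yh t))%:Z + \sum_j qs j t.

Lemma index_near_const t0 : t0 \in `[c, d] ->
  \forall t \near within [set` `[c, d]] (nbhs t0), f t = f t0 /\ g t = g t0.
Proof.
move=> t0cd; set F := within _ _.
have [x [Tu0 Thu0]] := exists_pencil_unitmx (YL t0cd) (YhL t0cd).
have [al [al0 alpi xE]] := exists_cotangent x.
have FF : Filter F by exact: within_filter.
have near_cd : \forall t \near F, t \in `[c, d] by exact: withinT.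
have sub_cvg (A : R -> 'M[R]_(n + n, n)) : {within `[c, d], continuous A} ->
    mxcvg (F := F) (fun t => usubmx (A t)) (usubmx (A t0)) /\
    mxcvg (F := F) (fun t => pencil x (A t)) (pencil x (A t0)).
  move=> cA; have AL := mxcvg_continuous t0cd cA.
  have Au : mxcvg (F := F) (fun t => usubmx (A t)) (usubmx (A t0)).
    by move=> i j; rewrite mxE; under eq_cvg do rewrite mxE; exact: AL.
  split=> //; apply: mxcvgB; first exact: mxcvgZ.
  by move=> i j; rewrite mxE; under eq_cvg do rewrite mxE; exact: AL.
have [XY TY] := sub_cvg _ cY; have [XYh TYh] := sub_cvg _ cYh.
have DY : mxcvg (F := F) (fun t => frame x (Y t)) (frame x (Y t0)).
  by apply: mxcvgM => //; exact: mxcvgV.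
have DYh : mxcvg (F := F) (fun t => frame x (Yh t)) (frame x (Yh t0)).
  by apply: mxcvgM => //; exact: mxcvgV.
have near_T := near_unitmx (FF := FF) TY Tu0.
have near_Th := near_unitmx (FF := FF) TYh Thu0.
have near_all : \forall t \near F, [/\ t \in `[c, d], pencil x (Y t) \in unitmx
    & pencil x (Yh t) \in unitmx].
  by apply: filterS3 near_cd near_T near_Th.
(* This turns the two rank conditions of an admissible system into constancy of the ranks of Dh - D
   and Dh. *)
have rank_frame t : t \in `[c, d] -> pencil x (Y t) \in unitmx ->
    pencil x (Yh t) \in unitmx ->
    \rank (frame x (Yh t) - frame x (Y t)) = \rank (wronskian (Yh t) (Y t)) /\
    \rank (frame x (Yh t)) = \rank (usubmx (Yh t)).
  move=> tcd Tu Thu; split; last by rewrite [in RHS](frame_usubmx Thu) [RHS]mxrankMfree ?row_free_unit.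
  rewrite -rank_wronskianC (frame_wronskian (YL tcd) (YhL tcd) Tu Thu).
  by rewrite mxrankMfree ?row_free_unit// eqmxMfull// row_full_unit unitmx_tr.
have near_Dh : \forall t \near F, ind (frame x (Yh t)) = ind (frame x (Yh t0)) /\
    ind (- frame x (Yh t)) = ind (- frame x (Yh t0)).
  apply: ind_near_eq => //; first exact: (frame_sym (YhL t0cd)).
    by apply: filterS near_all => t [tcd _ Thu]; exact: (frame_sym (YhL tcd)).
  apply: filterS near_all => t [tcd Tu Thu].
  have [_ ->] := rank_frame t tcd Tu Thu; have [_ ->] := rank_frame t0 t0cd Tu0 Thu0.
  exact: rX.
have near_DhD : \forall t \near F,
    ind (frame x (Yh t) - frame x (Y t)) = ind (frame x (Yh t0) - frame x (Y t0)) /\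
    ind (- (frame x (Yh t) - frame x (Y t))) = ind (- (frame x (Yh t0) - frame x (Y t0))).
  apply: (@ind_near_eq _ _ _ _ _ (fun t => frame x (Yh t) - frame x (Y t))).
  - exact: mxcvgB.
  - by rewrite trmxB !frame_sym//; [exact: YL|exact: YhL].
  - apply: filterS near_all => t [tcd Tu Thu].
    by rewrite trmxB !frame_sym//; [exact: YL|exact: YhL].
  - apply: filterS near_all => t [tcd Tu Thu].
    have [-> _] := rank_frame t tcd Tu Thu; have [-> _] := rank_frame t0 t0cd Tu0 Thu0.
    exact: rW.
have [_ _ side0] := lidskii_angles_count (YL t0cd) Tu0 (phiE t0cd).
have /choice[m mP] : forall j, exists m : int,
    2 * al - 2 * pi < phi j t0 - 2 * pi * m%:~R < 2 * al.
  by move=> j; apply: (angle_window al0 alpi xE); exact: side0.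
(* The windows are open, so the integers [m j] found at [t0] remain valid nearby. *)
have near_m : \forall t \near F, forall j,
    2 * al - 2 * pi < phi j t - 2 * pi * (m j)%:~R < 2 * al.
  apply: filter_forall => j.
  have phij : phi j t - 2 * pi * (m j)%:~R @[t --> F] --> phi j t0 - 2 * pi * (m j)%:~R.
    apply: cvgB; last exact: cvg_cst.
    by move: (@cphi j) => /subspace_continuousP/(_ t0 t0cd).
  have /andP[m1 m2] := mP j.
  apply: filterS2 (cvgr_gt _ phij _ m1) (cvgr_lt _ phij _ m2) => t -> ->//.
have sums t : t \in `[c, d] -> pencil x (Y t) \in unitmx ->
    (forall j, 2 * al - 2 * pi < phi j t - 2 * pi * (m j)%:~R < 2 * al) ->
    \sum_j q j t = \sum_j m j - (ind (- frame x (Y t)))%:Z /\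
    \sum_j qs j t = \sum_j (m j - 1) + (ind (frame x (Y t)))%:Z.
  move=> tcd Tu mt; have [<- <- _] := lidskii_angles_count (YL tcd) Tu (phiE tcd).
  rewrite !(big_morph Posz PoszD (erefl (Posz 0))) -sumrB -big_split/=; split; apply: eq_bigr => j _.
    exact: (floor_window al0 alpi xE (mt j) (hq j tcd)).
  exact: (ceil_window al0 alpi xE (mt j) (hqs j tcd)).
have idx t : t \in `[c, d] -> pencil x (Y t) \in unitmx -> pencil x (Yh t) \in unitmx ->
  _ := fun tcd Tu Thu => comp_index_frames Tu Thu (frame_sym (YL tcd) Tu)
    (frame_sym (YhL tcd) Thu) (frame_usubmx Tu) (frame_usubmx Thu)
    (frame_wronskian (YL tcd) (YhL tcd) Tu Thu).
have [i0 i0'] := idx t0 t0cd Tu0 Thu0; have [s0 s0'] := sums t0 t0cd Tu0 mP.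
apply: filterS3 (filterI near_all near_m) near_Dh near_DhD.
move=> t [[tcd Tu Thu] mt] [e1 e2] [e3 e4].
have [i1 i1'] := idx t tcd Tu Thu; have [s1 s1'] := sums t tcd Tu mt.
rewrite !opprB in e4.
rewrite e2 e3 -i0 in i1; rewrite e1 e4 -i0' in i1'.
rewrite /f /g s0 s1 s0' s1'.
by split; [exact: subz_transfer i1|exact: addz_transfer i1'].
Qed.

Lemma index_const : c <= d -> f c = f d /\ g c = g d.
Proof.
move=> cd; split; apply: locally_constant_itv => // x xcd;
  by apply: filterS (index_near_const xcd) => t [].
Qed.

End At.
End LocalConstancy.

(** * Oscillation systems *)

Lemma subz_exchange (x y u v : int) : x - u = y - v -> y - x = v - u.
Proof. by lia. Qed.

Lemma addz_exchange (x y u v : int) : x + u = y + v -> x - y = v - u.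
Proof. by lia. Qed.

Lemma mxcvg_cvg (R : realType) (T : Type) (F : set_system T) (FF : Filter F) m n
  (A : T -> 'M[R]_(m, n)) L : mxcvg (F := F) A L -> A x @[x --> F] --> L.
Proof.
move=> AL; apply/cvg_ballP => e e0.
have : \forall x \near F, forall i j, ball (L i j) e (A x i j).
  apply: filter_forall => i; apply: filter_forall => j.
  exact: (cvg_ball (AL i j) e0).
by apply: filterS => x h; split.
Qed.

Lemma usubmx_mul (R : realType) n p (M : 'M[R]_(n + n, p)) :
  usubmx M = row_mx 1%:M 0 *m M.
Proof. by rewrite -[in RHS](vsubmxK M) mul_row_col mul1mx mul0mx addr0. Qed.

Section OscillationSystems.
Variables (R : realType) (n : nat).
Implicit Types (Y : R -> 'M[R]_(n + n, n)) (a b c : R).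

(** [S] has the left inverse - J S^T J, so multiplication by it preserves the rank of the vertical
    plane. *)
Lemma symplectic_lagrangian (S : 'M[R]_(n + n)) : symplectic S ->
  lagrangian_plane (S *m Emx R n).
Proof.
move=> Ssym; split.
  rewrite trmx_mul -!mulmxA (mulmxA S^T) (mulmxA (S^T *m _)) Ssym /Emx /Jmx.
  rewrite mul_block_col tr_col_mx mul_row_col.
  by rewrite !(mulmx0, mul0mx, mulmx1, addr0, add0r, trmx0).
have Su : S \in unitmx.
  have JJ : Jmx R n *m - Jmx R n = 1%:M.
    rewrite /Jmx opp_block_mx mulmx_block !(mulmx0, mul0mx, mulmx1, mul1mx, oppr0, addr0, add0r).
    by rewrite opprK mulNmx mulmxN mul1mx opprK -scalar_mx_block.
  have : (- Jmx R n *m S^T *m Jmx R n) *m S = 1%:M.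
    by rewrite -(mulmxA (- Jmx R n)) -mulmxA Ssym mulNmx -mulmxN JJ.
  by case/mulmx1_unit.
rewrite -mxrank_tr trmx_mul mxrankMfree ?row_free_unit ?unitmx_tr// mxrank_tr.
apply/eqP; rewrite eqn_leq rank_leq_col/=.
have : (row_mx 0 1%:M : 'M[R]_(n, n + n)) *m Emx R n = 1%:M.
  by rewrite mul_row_col mul0mx mul1mx add0r.
by move=> E1; have := mxrankM_maxr (row_mx 0 1%:M : 'M[R]_(n, n + n)) (Emx R n); rewrite E1 mxrank1.
Qed.

(** It maps the vertical plane to one with upper block -1 whose Wronskian with [Y] is [pencil x Y];
    wherever the pencil is invertible, both rank conditions hold. *)
Definition shear (x : R) : 'M[R]_(n + n) := block_mx 0 (- 1%:M) 1%:M (- x%:M).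

Lemma shear_symplectic x : symplectic (shear x).
Proof.
rewrite /symplectic /shear /Jmx tr_block_mx !mulmx_block.
rewrite !(trmx0, trmx1, trmxN, tr_scalar_mx, mulmx0, mul0mx, mulmx1, mul1mx, oppr0, addr0, add0r, mulNmx, mulmxN, opprK).
by rewrite addNr.
Qed.

Lemma wronskian_shear x (Y : 'M[R]_(n + n, n)) :
  wronskian (shear x *m Emx R n) Y = pencil x Y.
Proof.
rewrite /shear /Emx mul_block_col !mulmx0 !add0r !mulmx1 wronskianE col_mxKu col_mxKd.
by rewrite !trmxN !tr_scalar_mx !mulNmx mul1mx mul_scalar_mx opprK addrC.
Qed.

Lemma nth_cat_chain a s1 s2 k :
  nth a (a :: s1 ++ s2) (size s1 + k) = nth a (last a s1 :: s2) k.
Proof.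
rewrite -cat_cons lastI cat_rcons nth_cat size_belast ltnNge leq_addr/=.
by rewrite addKn.
Qed.

Lemma osc_system_cat a b c Y s1 s2 R1 R2 :
  osc_system a b Y s1 R1 -> osc_system b c Y s2 R2 ->
  osc_system a c Y (s1 ++ s2)
    (fun k => if (k < size s1)%N then R1 k else R2 (k - size s1)%N).
Proof.
move=> [p1 sys1] [p2 sys2]; split; first exact: itv_partition_cat p1 p2.
move=> k; rewrite size_cat => k12; have [ks1|ks1] := ltnP k (size s1).
  have -> : nth a (a :: s1 ++ s2) k = nth a (a :: s1) k.
    by rewrite -cat_cons nth_cat /= ltnS ltnW.
  have -> : nth a (a :: s1 ++ s2) k.+1 = nth a (a :: s1) k.+1.
    by rewrite -cat_cons nth_cat /= ltnS ks1.
  exact: sys1.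
have lb : last a s1 = b by case: p1 => _ /eqP.
have [l lE] : exists l, k = (size s1 + l)%N by exists (k - size s1)%N; rewrite subnKC.
have ls2 : (l < size s2)%N by rewrite -(ltn_add2l (size s1)) -lE.
rewrite lE -addnS !nth_cat_chain lb addKn.
rewrite (set_nth_default b) ?[nth a _ _.+1](set_nth_default b)//=; last first.
  by rewrite ltnS ltnW.
exact: sys2.
Qed.

(** Near each point a fixed [x] keeps the pencil invertible, so the constant matrix [shear x] is
    admissible on short segments, which are then chained. *)
Lemma exists_osc_system a b Y : a <= b -> lagrangian_path a b Y ->
  exists s Rs, osc_system a b Y s Rs.
Proof.
move=> ab [cY YL].
pose P x y := exists s Rs, osc_system x y Y s Rs; rewrite -/(P a b).
apply: segment_chain => // [x y z [s1 [R1 sys1]] [s2 [R2 sys2]]|t0 t0ab].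
  by eexists; eexists; exact: osc_system_cat sys1 sys2.
have [x [Tu0 _]] := exists_pencil_unitmx (YL t0 t0ab) (YL t0 t0ab).
have near_T : \forall t \near within [set` `[a, b]] (nbhs t0), pencil x (Y t) \in unitmx.
  have AL := mxcvg_continuous t0ab cY.
  apply: near_unitmx Tu0; apply: mxcvgB; first apply: mxcvgZ.
    by move=> i j; rewrite mxE; under eq_cvg do rewrite mxE; exact: AL.
  by move=> i j; rewrite mxE; under eq_cvg do rewrite mxE; exact: AL.
have [e e0 eP] := near_within_itv near_T; exists e => // u v uab vab.
rewrite le_eqVlt => /predU1P[->|uv] ue ve.
  (* Partition points increase strictly, so a segment of length 0 gets the empty partition. *)
  by exists [::], (fun _ _ => 0); split=> //; split=> //=.
exists [:: v], (fun _ _ => shear x); split; first exact: itv_partition1.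
case=> // _ /=; split.
- by move=> ?; exact: cvg_cst.
- by move=> *; exact: shear_symplectic.
- have unit_T t : t \in `[u, v] -> pencil x (Y t) \in unitmx.
    rewrite in_itv/= => /andP[ut tv]; apply: eP.
      move: uab vab; rewrite !in_itv/= => /andP[au _] /andP[_ vb].
      by rewrite (le_trans au)// (le_trans tv).
    move: ue ve; rewrite !ltr_norml; lra.
  by move=> t w tuv wuv; rewrite !wronskian_shear !mxrank_unit ?unit_T.
- by [].
Qed.

Section Sum.
Variables (a b : R) (Y : R -> 'M[R]_(n + n, n)).
Variables (phi : 'I_n -> R -> R) (q qs : 'I_n -> R -> int).
Hypothesis hY : lagrangian_path a b Y.
Hypothesis hphi : continuous_lidskii_angles a b (fun t => Zmx (Y t)) phi.
Hypothesis hq : forall j t, t \in `[a, b] ->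
  2 * pi * (q j t)%:~R <= phi j t < 2 * pi * (q j t + 1)%:~R.
Hypothesis hqs : forall j t, t \in `[a, b] ->
  2 * pi * (qs j t)%:~R < phi j t <= 2 * pi * (qs j t + 1)%:~R.

(** On each subinterval [index_const] converts the jump of the index into that of the angle counts,
    whatever the matrices [Rs]; the sum telescopes. *)
Lemma osc_sumE s Rs : osc_system a b Y s Rs ->
  osc_sum a Y s Rs = \sum_j (q j b - q j a) /\
  dual_osc_sum a Y s Rs = \sum_j (qs j b - qs j a).
Proof.
case: hY => cY YL; case: hphi => cphi phiE [part sys].
pose t := nth a (a :: s).
have tb : t (size s) = b by rewrite /t -last_nth; case: part => _ /eqP.
have t_ab k : (k <= size s)%N -> t k \in `[a, b].
  move=> ks; rewrite in_itv/= /t (set_nth_default b)//.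
  by apply/andP; split; [exact: itv_partition_nth_ge part|exact: itv_partition_nth_le part].
have t_lt k : (k < size s)%N -> t k < t k.+1.
  by move=> ks; case: part => /(pathP a) /(_ k ks).
have step k : (k < size s)%N ->
    (comp_index (Y (t k.+1)) (Rs k (t k.+1) *m Emx R n))%:Z -
      (comp_index (Y (t k)) (Rs k (t k) *m Emx R n))%:Z =
      \sum_j q j (t k.+1) - \sum_j q j (t k) /\
    (dual_comp_index (Y (t k)) (Rs k (t k) *m Emx R n))%:Z -
      (dual_comp_index (Y (t k.+1)) (Rs k (t k.+1) *m Emx R n))%:Z =
      \sum_j qs j (t k.+1) - \sum_j qs j (t k).
  move=> ks; have [cR sR rW rX] := sys k ks.
  have sub u : u \in `[t k, t k.+1] -> u \in `[a, b].
    have := t_ab k (ltnW ks); have := t_ab k.+1 ks; rewrite !in_itv/=.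
    by move=> /andP[_ hb] /andP[ha _] /andP[h1 h2]; rewrite (le_trans ha)// (le_trans h2).
  have subs : [set` `[t k, t k.+1]] `<=` [set` `[a, b]] by move=> u /sub.
  pose Yh u := Rs k u *m Emx R n.
  have cYh : {within `[t k, t k.+1], continuous Yh}.
    apply/subspace_continuousP => u utk; apply: mxcvg_cvg; apply: mxcvgM.
      exact: mxcvg_continuous utk cR.
    exact: mxcvg_cst.
  have [] := @index_const R n (t k) (t k.+1) Y Yh phi q qs
    (continuous_subspaceW subs cY) cYh (fun u h => YL u (sub u h))
    (fun u h => symplectic_lagrangian (sR u h)) rW.
  - by move=> u w uI wI; rewrite !usubmx_mul !mulmxA; exact: rX.
  - by move=> j; exact: continuous_subspaceW subs (@cphi j).
  - by move=> u /sub; exact: phiE.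
  - by move=> j u /sub; exact: hq.
  - by move=> j u /sub; exact: hqs.
  - exact/ltW/t_lt.
  move=> f1 g1; split; first exact: (subz_exchange f1).
  exact: (addz_exchange g1).
have tele (Q : R -> int) : \sum_(k < size s) (Q (t k.+1) - Q (t k)) = Q b - Q a.
  by rewrite -(big_mkord xpredT (fun k => Q (t k.+1) - Q (t k))) telescope_sumr// tb.
rewrite !sumrB -!(tele (fun u => \sum_j _ j u)) /osc_sum /dual_osc_sum.
by split; apply: eq_bigr => k _; have [] := step k (ltn_ord k).
Qed.

End Sum.
End OscillationSystems.

Theorem theorem3p8 (R : realType) (n : nat) (a b : R) (hab : a <= b)
  (Y : R -> 'M[R]_(n + n, n)) (hY : lagrangian_path a b Y)
  (phi : 'I_n -> R -> R)
  (hphi : continuous_lidskii_angles a b (fun t => Zmx (Y t)) phi)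
  (q qs : 'I_n -> R -> int)
  (hq : forall (j : 'I_n) (t : R), t \in `[a, b] ->
     2 * pi * (q j t)%:~R <= phi j t < 2 * pi * (q j t + 1)%:~R)
  (hqs : forall (j : 'I_n) (t : R), t \in `[a, b] ->
     2 * pi * (qs j t)%:~R < phi j t <= 2 * pi * (qs j t + 1)%:~R) :
  osc_number Y a b = \sum_(j < n) (q j b - q j a) /\
  dual_osc_number Y a b = \sum_(j < n) (qs j b - qs j a).
Proof.
(* One system excludes the default value of [xget]; any value it may select is computed by
   [osc_sumE]. *)
have [s [Rs sys]] := exists_osc_system hab hY.
split; [rewrite /osc_number|rewrite /dual_osc_number]; case: xgetP => /=.
- by move=> _ _ [s' [Rs' [sys' ->]]]; have [] := osc_sumE hY hphi hq hqs sys'.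
- by move=> /(_ (osc_sum a Y s Rs)) []; exists s, Rs.
- by move=> _ _ [s' [Rs' [sys' ->]]]; have [] := osc_sumE hY hphi hq hqs sys'.
- by move=> /(_ (dual_osc_sum a Y s Rs)) []; exists s, Rs.
Qed.
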